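(* Let $\ell:[a,b]\to Gr(kn,2kn)$ be the Jacobi curve of $\mathcal{Q}$ and let $\mathcal{V}\subset\mathbb{R}^{2kn}$ be the subspace of vectors whose first $kn$ coordinates vanish. If $\ell(t^\ast)\cap\mathcal{V}=\{0\}$ for all $t^\ast\in(a,b]$, then $\mathcal{Q}$ is positive definite, that is, $\mathcal{Q}[h]\ge0$ for every smooth $h:[a,b]\to\mathbb{R}^n$ with $h^{(j)}(a)=h^{(j)}(b)=0$ for $0\le j\le k-1$, and $\mathcal{Q}[h]=0$ only when $h\equiv0$.
   Context: Let $a<b$ be real and $k,n\ge1$. Let $M_{ii}$ ($0\le i\le k$) and $M_{i(i+1)}$ ($0\le i\le k-1$) be smooth functions $[a,b]\to\mathbb{R}^{n\times n}$ with every $M_{ii}(t)$ symmetric and $M_{kk}(t)$ positive definite for all $t$ (strong Legendre condition). Put $$L(t,q_0,\dots,q_k)=\tfrac12\sum_{i=0}^kq_i^{\top}M_{ii}(t)q_i+\sum_{i=0}^{k-1}q_i^{\top}M_{i(i+1)}(t)q_{i+1},\qquad \mathcal{Q}[h]=\int_a^bL(t,h,\dot h,\dots,h^{(k)})\,dt .$$ The Jacobi (Euler-Lagrange) equation of $\mathcal{Q}$ is $\sum_{j=0}^k(-1)^j\frac{d^j}{dt^j}\Big(\frac{\partial L}{\partial q_j}(t,h,\dots,h^{(k)})\Big)=0$, a linear ODE of order $2k$ for $h:[a,b]\to\mathbb{R}^n$. Let $\{h_1,\dots,h_{2kn}\}$ be a fundamental set of solutions (basis of the solution space) of the Jacobi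 equation such that $h_i^{(j)}(a)=0$ for $1\le i\le kn$ and $0\le j\le k-1$, and let $\mathcal{A}(t)$ be the $2kn\times n$ matrix whose $i$-th row is $h_i(t)^{\top}$. The Jacobi curve $\ell(t)\in Gr(kn,2kn)$ is the span of the columns of the $2kn\times kn$ matrix $(\mathcal{A}(t)|\dot{\mathcal{A}}(t)|\cdots|\mathcal{A}^{(k-1)}(t))$. *)

(* Defs.v *)
From HB Require Import structures.
From mathcomp Require Import all_boot all_order all_algebra.
From mathcomp Require Import all_classical all_reals all_analysis.

Set Implicit Arguments.
Unset Strict Implicit.
Unset Printing Implicit Defensive.

Import Order.TTheory GRing.Theory Num.Theory.
Import numFieldNormedType.Exports.

Local Open Scope classical_set_scope.
Local Open Scope ring_scope.

(* Functions on [a, b] are represented by total functions on R, of which only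
   the values on [a, b] matter: derivatives are limits of difference quotients
   inside [a, b], hence one-sided at a and at b. *)
Section DerivativesOnSegment.
Context {R : realType} {V : normedModType R}.
Implicit Types (a b t : R) (f : R -> V).

Definition diff_quot f t : R -> V := fun s => (s - t)^-1 *: (f s - f t).

Definition seg_derivable a b f t : Prop :=
  cvg (diff_quot f t @ within `[a, b] t^').

Definition seg_deriv a b f : R -> V :=
  fun t => lim (diff_quot f t @ within `[a, b] t^').

Definition seg_derivn a b (j : nat) f : R -> V := iter j (seg_deriv a b) f.

Definition seg_nderivable a b (m : nat) f : Prop :=
  forall j, (j < m)%N -> forall t, t \in `[a, b] ->
    seg_derivable a b (seg_derivn a b j f) t.

Definition seg_smooth a b f : Prop := forall m, seg_nderivable a b m f.

End DerivativesOnSegment.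

Definition posdefmx (R : realType) (n : nat) (A : 'M[R]_n) : Prop :=
  forall x : 'cV[R]_n, x != 0 -> 0 < (x^T *m A *m x) 0 0.

Section QuadraticFunctional.
Context {R : realType}.
Variables (a b : R) (k n : nat).
(* Md i is M_ii, used for i <= k, and Mo i is M_i(i+1), used for i < k. *)
Variables (Md Mo : nat -> R -> 'M[R]_n).

(* Only q 0, ..., q k are used. *)
Definition lagrangian (t : R) (q : nat -> 'cV[R]_n) : R :=
  2^-1 * (\sum_(i < k.+1) ((q i)^T *m Md i t *m q i) 0 0)
  + \sum_(i < k) ((q i)^T *m Mo i t *m q i.+1) 0 0.

Definition jet (h : R -> 'cV[R]_n) (t : R) : nat -> 'cV[R]_n :=
  fun j => seg_derivn a b j h t.

Definition quad_functional (h : R -> 'cV[R]_n) : R :=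
  \int[lebesgue_measure]_(t in `[a, b]) lagrangian t (jet h t).

(* The gradient of L(t, q_0, ..., q_k) in the vector variable q_j. *)
Definition lagrangian_grad (j : nat) (t : R) (q : nat -> 'cV[R]_n)
    : 'cV[R]_n :=
  \col_l derive (fun x : 'cV[R]_n => lagrangian t [eta q with j |-> x])
                (q j) (delta_mx l 0).

Definition jacobi_operator (h : R -> 'cV[R]_n) (t : R) : 'cV[R]_n :=
  \sum_(j < k.+1)
    (-1) ^+ j *: seg_derivn a b j (fun s => lagrangian_grad j s (jet h s)) t.

Definition jacobi_solution (h : R -> 'cV[R]_n) : Prop :=
  seg_nderivable a b (2 * k) h /\
  forall t, t \in `[a, b] -> jacobi_operator h t = 0.

Definition fundamental_set (N : nat) (h : 'I_N -> R -> 'cV[R]_n) : Prop :=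
  [/\ forall i, jacobi_solution (h i),
      forall c : 'I_N -> R,
        (forall t, t \in `[a, b] -> \sum_i c i *: h i t = 0) ->
        forall i, c i = 0
    & forall g, jacobi_solution g -> exists c : 'I_N -> R,
        forall t, t \in `[a, b] -> g t = \sum_i c i *: h i t].

Definition vanishing_ends (h : R -> 'cV[R]_n) : Prop :=
  forall j, (j < k)%N ->
    seg_derivn a b j h a = 0 /\ seg_derivn a b j h b = 0.

Definition quad_functional_posdef : Prop :=
  forall h : R -> 'cV[R]_n, seg_smooth a b h -> vanishing_ends h ->
    0 <= quad_functional h /\
    (quad_functional h = 0 -> forall t, t \in `[a, b] -> h t = 0).

End QuadraticFunctional.

Section JacobiCurve.
Context {R : realType}.

Definition colspan (m p : nat) (B : 'M[R]_(m, p)) : {vspace 'cV[R]_m} :=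
  <<[seq col c B | c : 'I_p]>>%VS.

Definition solution_mx (N n : nat) (h : 'I_N -> R -> 'cV[R]_n) (t : R)
    : 'M[R]_(N, n) :=
  \matrix_(i < N, l < n) h i t l 0.

Definition jacobi_curve (a b : R) (k N n : nat) (h : 'I_N -> R -> 'cV[R]_n)
    (t : R) : {vspace 'cV[R]_N} :=
  colspan (\mxrow_(j < k) seg_derivn a b j (solution_mx h) t).

Definition vertical_space (p q : nat) : {vspace 'cV[R]_(p + q)} :=
  lker (linfun (usubmx : 'cV[R]_(p + q) -> 'cV[R]_p)).

End JacobiCurve.

(* Main.v *)
Require Import Defs.
From mathcomp Require Import all_boot all_order all_algebra.
From mathcomp Require Import all_classical all_reals all_analysis.
From mathcomp Require Import ring lra.
Import Order.TTheory GRing.Theory Num.Theory.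
Import numFieldNormedType.Exports.
Local Open Scope classical_set_scope.
Local Open Scope ring_scope.
Set Implicit Arguments.
Unset Strict Implicit.
Unset Printing Implicit Defensive.

(** Consider the [k * n] solutions of the Jacobi equation that vanish at [a]
    together with their first [k - 1] derivatives.  Where the square matrix of
    their jets is invertible, the functional is, up to a boundary term, the
    integral of a square: this is Picone's identity [picone].

    Transversality of the Jacobi curve to the vertical space at [t] means that
    this matrix is invertible at [t].  Indeed a combination of the columns whose
    first [k * n] entries vanish is zero by transversality, and the columns are
    independent because the jets and momenta of a whole fundamental set form an
    invertible matrix ([phase_mx_unit], [frame_unit]).  For this, uniqueness of
    solutions suffices: [2 k n] independent solutions have independent initial
    data at every point.

    The matrix is zero at [a], so Picone's identity is used only on [s, b], with
    [s] slightly larger than [a].  On [a, s] the jet [y] of the given function is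
    compared with the solution [z] that has the same jet as [y] at [s] and zero
    jet at [a].  Green's formula [seg_D_pairing] shows that the
    integral of the Lagrangian of [y] is that of [y - z] plus a boundary term, and
    the boundary terms of the two segments cancel at [s].  Since [y - z] has zero
    jets at both ends of a short segment, its integral is nonnegative by the
    strong Legendre condition and a Poincare inequality
    ([lagrangian_garding], [weighted_poincare]).  If the total is zero, the square
    on [s, b] vanishes, so the coefficients of [y] in the frame are
    constant; they are zero at [b], hence [y = 0] on [s, b], so [z = 0], and
    [y = y - z = 0] on [a, s].

    All these comparisons are pointwise inequalities [F' <= L] between a derivative
    and the Lagrangian, integrated at the very end by [FTC_le].  The Jacobi
    equation enters through its Hamiltonian form [extremal], a first-order
    system. *)

(** * Derivatives relative to a segment *)

Section SegDerivative.
Context {R : realType}.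
Implicit Types (a b t : R).

(** A relation instead of the total operator [seg_deriv]: it records at once
    that the limit exists and what it is. *)
Definition seg_D {V : normedModType R} a b (f g : R -> V) : Prop :=
  forall t, t \in `[a, b] -> diff_quot f t @ within `[a, b] t^' --> g t.

Lemma seg_punctured_proper a b t : a < b -> t \in `[a, b] ->
  ProperFilter (within `[a, b] t^').
Proof.
move=> ab; rewrite in_itv /= => /andP[at_ tb].
apply: Build_ProperFilter_ex => P [e /= e0 He].
have [tb'|bt] := ltP t b.
  exists (Num.min b (t + e / 2)).
  have h1 : t < Num.min b (t + e / 2) by rewrite lt_min tb' ltrDl divr_gt0.
  apply: He.
  - rewrite /ball_ /= ltr0_norm ?subr_lt0// opprB ltrBlDl.
    by rewrite gt_min; apply/orP; right; rewrite ltrD2l gtr_pMr// invf_lt1// ltr1n.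
  - by rewrite gt_eqF.
  - by rewrite /= in_itv /= (le_trans at_ (ltW h1)) ge_min lexx.
have a_t : a < t by apply: lt_le_trans ab bt.
exists (Num.max a (t - e / 2)).
have h1 : Num.max a (t - e / 2) < t by rewrite gt_max a_t gtrBl divr_gt0.
apply: He.
- rewrite /ball_ /= gtr0_norm ?subr_gt0// ltrBlDl -ltrBlDr.
  by rewrite lt_max; apply/orP; right; rewrite ltrD2l ltrN2 gtr_pMr// invf_lt1// ltr1n.
- by rewrite lt_eqF.
- by rewrite /= in_itv /= le_max lexx (le_trans (ltW h1) tb).
Qed.

Lemma itv_cc_sub (a b a' b' t : R) : a <= a' -> b' <= b -> t \in `[a', b'] -> t \in `[a, b].
Proof.
by rewrite !in_itv /= => h1 h2 /andP[h3 h4]; rewrite (le_trans h1)// (le_trans h4).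
Qed.

Lemma near_seg_punctured a b t (P : set R) :
  (forall s, s \in `[a, b] -> s != t -> P s) ->
  \forall s \near within `[a, b] t^', P s.
Proof.
by move=> H; exists 1 => //= s _ st sab; apply: H.
Qed.

Section Normed.
Context {V : normedModType R}.
Implicit Types f g : R -> V.

Lemma seg_D_derivE a b f g t : a < b -> seg_D a b f g -> t \in `[a, b] ->
  seg_deriv a b f t = g t.
Proof.
move=> ab D tab; have := seg_punctured_proper ab tab => PF.
have h := D t tab; apply/(cvg_lim _ h); exact: norm_hausdorff.
Qed.

Lemma seg_D_unique a b f g1 g2 t : a < b ->
  seg_D a b f g1 -> seg_D a b f g2 -> t \in `[a, b] -> g1 t = g2 t.
Proof.
by move=> ab D1 D2 tab; rewrite -(seg_D_derivE ab D1 tab) (seg_D_derivE ab D2 tab).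
Qed.

Lemma derivable_seg_D a b f :
  (forall t, t \in `[a, b] -> seg_derivable a b f t) ->
  seg_D a b f (seg_deriv a b f).
Proof. by move=> H t /H. Qed.

Lemma seg_D_derivable a b f g t :
  seg_D a b f g -> t \in `[a, b] -> seg_derivable a b f t.
Proof. by move=> D tab; apply/cvg_ex; exists (g t); apply: D. Qed.

Lemma seg_D_ext a b f1 f2 g1 g2 :
  {in `[a, b], f1 =1 f2} -> {in `[a, b], g1 =1 g2} ->
  seg_D a b f1 g1 -> seg_D a b f2 g2.
Proof.
move=> fE gE D t tab; rewrite -gE//.
apply: cvg_trans (D t tab); apply: near_eq_cvg.
by apply: near_seg_punctured => s sab _; rewrite /diff_quot !fE.
Qed.

Lemma seg_D_sub a b a' b' f g : a <= a' -> b' <= b ->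
  seg_D a b f g -> seg_D a' b' f g.
Proof.
move=> aa bb D t tab.
have sub s : s \in `[a', b'] -> s \in `[a, b].
  rewrite !in_itv /= => /andP[h1 h2].
  by rewrite (le_trans aa h1) (le_trans h2 bb).
apply: cvg_trans (D t (sub _ tab)) => P.
rewrite !nbhs_simpl /within /=; apply: filterS => s H h.
by apply: H; apply: sub.
Qed.

(** Differentiability gives continuity, since
    [f s = f t + (s - t) *: diff_quot f t s]. *)
Lemma seg_D_cvg a b f g t : seg_D a b f g -> t \in `[a, b] ->
  f s @[s --> within `[a, b] t^'] --> f t.
Proof.
move=> D tab.
have h : (fun s => f t + (s - t) *: diff_quot f t s) @ within `[a, b] t^' -->
   f t + (t - t) *: g t.
  apply: cvgD; first exact: cvg_cst.
  apply: cvgZ; last exact: D.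
  apply: cvgB; last exact: cvg_cst.
  by move=> P h; apply: cvg_within; apply: cvg_within.
rewrite subrr scale0r addr0 in h.
apply: cvg_trans h; apply: near_eq_cvg.
apply: near_seg_punctured => s sab st; rewrite /diff_quot scalerA divff ?subr_eq0//.
by rewrite scale1r addrC subrK.
Qed.

Lemma seg_D_cst a b (v : V) : seg_D a b (fun=> v) (fun=> 0).
Proof.
move=> t tab; rewrite (_ : diff_quot _ t = fun=> 0); first exact: cvg_cst.
by apply/funext => s; rewrite /diff_quot subrr scaler0.
Qed.

Lemma seg_D_add a b f1 f2 g1 g2 : seg_D a b f1 g1 -> seg_D a b f2 g2 ->
  seg_D a b (fun t => f1 t + f2 t) (fun t => g1 t + g2 t).
Proof.
move=> D1 D2 t tab.
rewrite (_ : diff_quot _ t = fun s => diff_quot f1 t s + diff_quot f2 t s).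
  by apply: cvgD; [exact: D1|exact: D2].
by apply/funext => s; rewrite /diff_quot opprD addrACA scalerDr.
Qed.

Lemma seg_D_sum (I : Type) (r : seq I) (P : pred I) a b (f g : I -> R -> V) :
  (forall i, P i -> seg_D a b (f i) (g i)) ->
  seg_D a b (fun t => \sum_(i <- r | P i) f i t)
            (fun t => \sum_(i <- r | P i) g i t).
Proof.
move=> D; elim: r => [|i r IH].
  by apply: seg_D_ext (seg_D_cst 0) => t _; rewrite big_nil.
case Pi: (P i).
  by apply: seg_D_ext (seg_D_add (D i Pi) IH) => t _; rewrite big_cons Pi.
by apply: seg_D_ext IH => t _; rewrite big_cons Pi.
Qed.

Lemma seg_D_scale a b (c c' : R -> R) f g : seg_D a b c c' -> seg_D a b f g ->
  seg_D a b (fun t => c t *: f t) (fun t => c' t *: f t + c t *: g t).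
Proof.
move=> Dc Df t tab.
rewrite (_ : diff_quot _ t = fun s =>
  diff_quot c t s *: f s + c t *: diff_quot f t s).
  apply: cvgD; first by apply: cvgZ; [exact: Dc|exact: seg_D_cvg Df tab].
  by apply: cvgZ; [exact: cvg_cst|exact: Df].
apply/funext => s; rewrite /diff_quot.
set d := (s - t)^-1.
have -> : (d *: (c s - c t)) *: f s = d *: ((c s - c t) *: f s).
  by rewrite scalerA.
have -> : c t *: (d *: (f s - f t)) = d *: (c t *: (f s - f t)).
  by rewrite !scalerA mulrC.
by rewrite -scalerDr; congr (_ *: _); rewrite scalerBl scalerBr addrA subrK.
Qed.

Lemma seg_D_scalel a b (c : R) f g : seg_D a b f g ->
  seg_D a b (fun t => c *: f t) (fun t => c *: g t).
Proof.
move=> D t tab.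
rewrite (_ : diff_quot _ t = fun s => c *: diff_quot f t s).
  by apply: cvgZ; [exact: cvg_cst|exact: D].
by apply/funext => s; rewrite /diff_quot -scalerBr !scalerA mulrC.
Qed.

End Normed.

Lemma seg_D_mul a b (f f' g g' : R -> R) : seg_D a b f f' -> seg_D a b g g' ->
  seg_D a b (fun t => f t * g t) (fun t => f' t * g t + f t * g' t).
Proof. exact: seg_D_scale. Qed.

Lemma seg_D_id a b : seg_D a b (fun t : R => t) (fun=> 1).
Proof.
move=> t tab.
have h : (fun=> 1 : R) @ within `[a, b] t^' --> (1 : R) by exact: cvg_cst.
apply: cvg_trans h; apply: near_eq_cvg.
apply: near_seg_punctured => s sab st.
by rewrite /diff_quot /= [_ *: _]mulVf// subr_eq0.
Qed.

Lemma seg_D_inv a b (f g : R -> R) : seg_D a b f g ->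
  (forall t, t \in `[a, b] -> f t != 0) ->
  seg_D a b (fun t => (f t)^-1) (fun t => - g t / f t ^+ 2).
Proof.
move=> D f0 t tab.
have h : (fun s => - diff_quot f t s / (f t * f s)) @ within `[a, b] t^' -->
   - g t / f t ^+ 2.
  apply: cvgM; first by apply: cvgN; exact: D.
  rewrite expr2; apply: cvgV; first by rewrite mulf_neq0 ?f0.
  by apply: cvgM; [exact: cvg_cst|exact: seg_D_cvg D tab].
apply: cvg_trans h; apply: near_eq_cvg.
apply: near_seg_punctured => s sab st; rewrite /diff_quot /GRing.scale /=.
by field; rewrite !f0//= subr_eq0.
Qed.

(** A neighbourhood of a matrix contains a finite intersection of conditions on
    its entries, so entrywise limits are limits of matrices. *)
Lemma cvg_mxP {T : Type} (F : set_system T) m n (FF : Filter F)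
    (f : T -> 'M[R]_(m, n)) (A : 'M[R]_(m, n)) :
  (forall i j, f x i j @[x --> F] --> A i j) -> f @ F --> A.
Proof.
move=> H P [Q HQ sub].
have : \forall x \near F, forall i j, Q i j (f x i j).
  apply: filter_forall => i; apply: filter_forall => j.
  exact: H (HQ i j).
by apply: filterS => x Hx; apply: sub.
Qed.

Lemma seg_D_mxP m n a b (f g : R -> 'M[R]_(m, n)) :
  seg_D a b f g <->
  forall i j, seg_D a b (fun t => f t i j) (fun t => g t i j).
Proof.
split=> [D i j t tab|D t tab].
  have h : (fun s => (diff_quot f t s) i j) @ within `[a, b] t^' --> g t i j.
    have c := @coord_continuous R m n i j (g t).
    have D' := D t tab.
    have FF : Filter (within `[a, b] t^') by typeclasses eauto.
    by have := continuous_cvg FF c D'; exact.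
  apply: cvg_trans h; apply: near_eq_cvg; apply: near_seg_punctured => s _ _.
  by rewrite /diff_quot !mxE.
apply: cvg_mxP => i j.
apply: cvg_trans (D i j t tab); apply: near_eq_cvg; apply: near_seg_punctured.
by move=> s _ _; rewrite /diff_quot !mxE.
Qed.

Lemma seg_D_mulmx m n p a b (f f' : R -> 'M[R]_(m, n)) (g g' : R -> 'M[R]_(n, p)) :
  seg_D a b f f' -> seg_D a b g g' ->
  seg_D a b (fun t => f t *m g t) (fun t => f' t *m g t + f t *m g' t).
Proof.
move=> /seg_D_mxP Df /seg_D_mxP Dg; apply/seg_D_mxP => i j.
apply: seg_D_ext (seg_D_sum (fun l (_ : true) => seg_D_mul (Df i l) (Dg l j))) => t _.
  by rewrite mxE.
by rewrite !mxE -big_split.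
Qed.

Lemma seg_D_trmx m n a b (f g : R -> 'M[R]_(m, n)) :
  seg_D a b f g -> seg_D a b (fun t => (f t)^T) (fun t => (g t)^T).
Proof.
move=> /seg_D_mxP D; apply/seg_D_mxP => i j.
by apply: seg_D_ext (D j i) => t _; rewrite mxE.
Qed.

End SegDerivative.

(** * Monotonicity and integrals *)

Section RealCalculus.
Context {R : realType}.
Implicit Types (a b t : R) (f g : R -> R).
Notation mu := (@lebesgue_measure R).

Lemma seg_D_continuous a b f g : seg_D a b f g ->
  {within `[a, b], continuous f}.
Proof.
move=> D; apply/subspace_continuousP => t tab P nP.
have := seg_D_cvg D tab nP; rewrite /= => H.
have [e /= e0 He] := H.
exists e => //= s bs sab.
(* The punctured limit says nothing about the point [t] itself. *)
have [->|st] := eqVneq s t; first exact: nbhs_singleton.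
exact: (He s bs st sab).
Qed.

Lemma seg_D_is_derive a b f g t : seg_D a b f g -> t \in `]a, b[ ->
  is_derive t 1 f (g t).
Proof.
move=> D tab.
have tab' : t \in `[a, b] by apply: subset_itv_oo_cc.
suff h : (fun h => h^-1 *: (f (h *: 1 + t) - f t)) @ 0^' --> g t.
  split; first by apply/cvg_ex; exists (g t).
  by apply/(cvg_lim _ h); exact: norm_hausdorff.
move=> P nP; have [e /= e0 He] := D t tab' P nP.
have : nbhs t `]a, b[%classic by apply: near_in_itvoo.
move=> [d /= d0 Hd].
exists (Num.min e d); rewrite /= ?lt_min ?e0// => h /=.
rewrite sub0r normrN lt_min => /andP[he hd] h0.
have ht : (h *: 1 + t) - t = h by rewrite addrK [_ *: _]mulr1.
have := He (h *: 1 + t); rewrite /diff_quot /preimage /= ht; apply.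
- by rewrite -opprB ht normrN.
- by rewrite -subr_eq0 ht.
- by apply: subset_itv_oo_cc; apply: Hd; rewrite /= -opprB ht normrN.
Qed.

(** Differentiability is asked only in the open segment, so that the lemma
    covers indefinite integrals of functions continuous on the segment. *)
Lemma ge0_D_le a b f g : {within `[a, b], continuous f} ->
  (forall t, t \in `]a, b[ -> is_derive t 1 f (g t)) ->
  (forall t, t \in `]a, b[ -> 0 <= g t) ->
  {in `[a, b] &, {homo f : s t / s <= t}}.
Proof.
move=> fc fD g0; apply: ger0_derive1_le_cc => // t tab.
  by have [] := fD t tab.
by rewrite derive1E; have /@derive_val -> := fD t tab; apply: g0.
Qed.

Lemma seg_D_ge0_le a b f g : seg_D a b f g ->
  (forall t, t \in `[a, b] -> 0 <= g t) ->
  {in `[a, b] &, {homo f : s t / s <= t}}.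
Proof.
move=> D g0; apply: (@ge0_D_le _ _ _ g).
- exact: seg_D_continuous D.
- by move=> t; apply: seg_D_is_derive D.
- by move=> t tab; apply/g0/subset_itv_oo_cc.
Qed.

Lemma seg_D_eq0_cst a b f g : a <= b -> seg_D a b f g ->
  (forall t, t \in `]a, b[ -> g t = 0) ->
  forall t, t \in `[a, b] -> f t = f b.
Proof.
move=> ab D g0 t tab.
have bab : b \in `[a, b] by rewrite in_itv /= lexx ab.
have tb : t <= b by move: tab; rewrite in_itv => /andP[].
have mono (c : R) : c * f t <= c * f b.
  have Dc := seg_D_scalel (c := c) D.
  apply: (ge0_D_le (seg_D_continuous Dc) (g := fun s => c *: g s) _ _ tab bab tb).
    by move=> s; apply: seg_D_is_derive Dc.
  by move=> s sab; rewrite g0// scaler0.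
by have := mono 1; have := mono (-1); rewrite !mulN1r lerN2 !mul1r => h1 h2; apply/le_anti/andP.
Qed.

Lemma seg_D_bounded a b f g : seg_D a b f g ->
  exists K, forall t, t \in `[a, b] -> `|f t| <= K.
Proof.
move=> D; have fc := seg_D_continuous D.
have [ba|ab] := ltP b a.
  exists 0 => t; rewrite in_itv /= => /andP[h1 h2].
  by have := lt_le_trans ba (le_trans h1 h2); rewrite ltxx.
have [c1 _ H1] := EVT_max ab fc; have [c2 _ H2] := EVT_min ab fc.
exists (Num.max (f c1) (- f c2)) => t tab.
by rewrite ler_norml lerNl !le_max lerN2 H1// H2// orbT.
Qed.

Lemma Rintegral_split (a s b : R) (f : R -> R) : a < s -> s < b ->
  {within `[a, b], continuous f} ->
  \int[lebesgue_measure]_(t in `[a, b]) f t =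
  \int[lebesgue_measure]_(t in `[a, s]) f t + \int[lebesgue_measure]_(t in `[s, b]) f t.
Proof.
move=> as_ sb fc.
have intf : (@lebesgue_measure R).-integrable `[a, b] (EFin \o f).
  by apply: continuous_compact_integrable => //; exact: segment_compact.
have := Rintegral_itvB intf (_ : (BLeft a <= BRight s)%O) (_ : (BRight s <= BRight b)%O).
rewrite !bnd_simp !ltW// => /(_ isT isT).
rewrite Rintegral_itv_obnd_cbnd.
  by move=> <-; rewrite addrC subrK.
apply: integrableS intf => //.
by move=> t /=; rewrite !in_itv /= => /andP[st ->]; rewrite (ltW (lt_trans as_ st)).
Qed.

(** The difference [J] of the indefinite integral of [f] and of [F] has
    derivative [f - F' >= 0].  It is thus nondecreasing; when it takes the same
    value at both ends it is constant, so its derivative vanishes inside. *)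
Lemma FTC_le a b f (F F' : R -> R) : a < b -> {within `[a, b], continuous f} ->
  seg_D a b F F' -> (forall t, t \in `[a, b] -> F' t <= f t) ->
  F b - F a <= \int[mu]_(t in `[a, b]) f t /\
  (F b - F a = \int[mu]_(t in `[a, b]) f t ->
   forall t, t \in `]a, b[ -> f t = F' t).
Proof.
move=> ab fc D le.
have intf : mu.-integrable `[a, b] (EFin \o f).
  by apply: continuous_compact_integrable => //; exact: segment_compact.
pose I x := \int[mu]_(t in `[a, x]) f t.
have Ic : {within `[a, b], continuous I}.
  exact: (parameterized_integral_continuous (ltW ab) intf).
have ID t : t \in `]a, b[ -> is_derive t 1 I (f t).
  move=> tab; move: (tab); rewrite in_itv /= => /andP[at_ tb].
  have ft : {for t, continuous f}.
    have /continuous_within_itvP := fc => /(_ ab) [fo _ _].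
    exact: fo.
  have [d1 d2] := continuous_FTC1_closed tb intf at_ ft.
  by apply: DeriveDef; [exact: d1|rewrite -derive1E; exact: d2].
pose J := I - F.
have JD t : t \in `]a, b[ -> is_derive t 1 J (f t - F' t).
  move=> tab; apply: is_deriveB; first exact: ID.
  exact: seg_D_is_derive D tab.
have Jc : {within `[a, b], continuous J}.
  move=> x; apply: continuousB; [exact: Ic|exact: (seg_D_continuous D)].
have mono : {in `[a, b] &, {homo J : s t / s <= t}}.
  apply: ge0_D_le Jc JD _ => t tab; rewrite subr_ge0; apply: le.
  exact: subset_itv_oo_cc.
have aab : a \in `[a, b] by rewrite in_itv /= lexx ltW.
have bab : b \in `[a, b] by rewrite in_itv /= lexx ltW.
have Ja : J a = - F a.
  by rewrite /J /= !fctE /I set_itv1 Rintegral_set1 add0r.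
split=> [|eq].
  have := mono _ _ aab bab (ltW ab); rewrite Ja /J !fctE /I; lra.
move=> t tab.
have Jcst s : s \in `[a, b] -> J s = J a.
  move=> sab; have /andP[as_ sb] : a <= s <= b by rewrite in_itv in sab.
  apply/eqP; rewrite eq_le (mono _ _ aab sab as_) andbT.
  have -> : J a = J b by rewrite Ja /J !fctE /I -eq; lra.
  exact: mono.
have J0 : is_derive t 1 J 0.
  apply: (@near_eq_is_derive R R R (cst (J a)) J t 1 0 _ (is_derive_cst _ _ _)).
  near=> s; rewrite /= Jcst//; apply: subset_itv_oo_cc.
  by near: s; exact: near_in_itvoo.
have := JD t tab => /@derive_val; rewrite (@derive_val _ _ _ _ _ _ _ J0) => h.
by apply/eqP; rewrite -subr_eq0 -h.
Unshelve. all: by end_near. Qed.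

End RealCalculus.

(** * Linear growth *)

Section LinearGrowth.
Context {R : realType}.
Implicit Types (a b t : R).

Lemma is_derive_seg_D a b (f g : R -> R) :
  (forall t, is_derive t 1 f (g t)) -> seg_D a b f g.
Proof.
move=> fD t tab.
have h : (fun h => h^-1 *: (f (h *: 1 + t) - f t)) @ 0^' --> g t.
  have /@derive_val <- := fD t; have [d _] := fD t; exact: d.
move=> P nP; have [e /= e0 He] := h P nP.
exists e => //= s bs st _.
have -> : diff_quot f t s = (s - t)^-1 *: (f ((s - t) *: 1 + t) - f t).
  by rewrite [(s - t) *: 1]mulr1 subrK.
apply: He; last by rewrite /= subr_eq0.
by rewrite /= sub0r normrN distrC.
Qed.

Lemma seg_D_expR a b (c : R) :
  seg_D a b (fun t => expR (c * t)) (fun t => c * expR (c * t)).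
Proof.
apply: is_derive_seg_D => t.
have h : is_derive t 1 (fun t => c * t) c.
  by have := is_deriveZ c (is_derive_id t (1 : R)); rewrite /GRing.scale/= mulr1.
have := is_derive1_comp (is_derive_expR (c * t)) h.
by rewrite mulrC.
Qed.

(** Gronwall's argument: [N = \sum_i v i ^ 2] satisfies [|N'| <= C N], so
    [expR (- C t) * N t] is nonincreasing and [expR (C t) * N t] is
    nondecreasing.  The first forces [N = 0] after [t0], the second before. *)
Lemma linear_growth_eq0 (I : finType) a b (v v' : I -> R -> R) (K t0 : R) :
  0 <= K ->
  (forall i, seg_D a b (v i) (v' i)) ->
  (forall t i, t \in `[a, b] -> `|v' i t| <= K * \sum_l `|v l t|) ->
  t0 \in `[a, b] -> (forall i, v i t0 = 0) ->
  forall t i, t \in `[a, b] -> v i t = 0.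
Proof.
move=> K0 D bnd t0ab v0 t i tab.
pose N t := \sum_i v i t ^+ 2.
pose N' t := \sum_i 2 * (v i t * v' i t).
have DN : seg_D a b N N'.
  apply: seg_D_sum => j _; apply: seg_D_ext (seg_D_mul (D j) (D j)) => s _ //.
  by rewrite [v' j s * _]mulrC -mulr2n mulr_natl.
pose m : R := \sum_(i : I) 1.
have mE x : \sum_(i : I) x = m * x.
  by rewrite mulr_suml; apply: eq_bigr => j _; rewrite mul1r.
pose C := 2 * (K * m).
have NC s : s \in `[a, b] -> `|N' s| <= C * N s.
  move=> sab; apply: (@le_trans _ _
      (\sum_j \sum_l K * (v j s ^+ 2 + v l s ^+ 2))).
    apply: le_trans (ler_norm_sum _ _ _) _; apply: ler_sum => j _.
    rewrite !normrM gtr0_norm//.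
    have h : 2 * (`|v j s| * `|v' j s|) <=
             2 * (`|v j s| * (K * \sum_l `|v l s|)).
      by rewrite ler_pM2l// ler_wpM2l// bnd.
    apply: le_trans h _; rewrite !mulr_sumr; apply: ler_sum => l _.
    have := sqr_ge0 (`|v j s| - `|v l s|).
    rewrite sqrrB !real_normK ?num_real// => h.
    set p := `|v j s| in h *; set q := `|v l s| in h *.
    have -> : 2 * (p * (K * q)) = K * (2 * (p * q)) by ring.
    by rewrite ler_wpM2l//; lra.
  have -> : \sum_j \sum_l K * (v j s ^+ 2 + v l s ^+ 2) =
            \sum_j K * (m * v j s ^+ 2 + N s).
    by apply: eq_bigr => j _; rewrite -mulr_sumr big_split/= mE.
  rewrite -mulr_sumr big_split/= -mulr_sumr mE.
  have -> : C * N s = K * (m * N s + m * N s) by rewrite /C; ring.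
  exact: lexx.
have N0 s : s \in `[a, b] -> 0 <= N s.
  by move=> _; apply: sumr_ge0 => j _; apply: sqr_ge0.
have Nt0 : N t0 = 0 by rewrite /N big1// => j _; rewrite v0 expr0n.
suff Nt : N t <= 0.
  have : v i t ^+ 2 <= 0.
    apply: le_trans Nt; rewrite /N (bigD1 i)//= lerDl.
    by apply: sumr_ge0 => j _; apply: sqr_ge0.
  by move=> h; apply/eqP; rewrite -sqrf_eq0 eq_le sqr_ge0 andbT.
have mono (c : R) : seg_D a b (fun s => expR (c * s) * N s)
    (fun s => expR (c * s) * (c * N s + N' s)).
  have := seg_D_mul (@seg_D_expR a b c) DN.
  apply: seg_D_ext => s _ //=; ring.
have E0 (c s : R) : 0 < expR (c * s) by apply: expR_gt0.
have [t0t|tt0] := leP t0 t.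
  have D1 := seg_D_scalel (c := -1) (mono (- C)).
  have := seg_D_ge0_le D1 _ t0ab tab t0t.
  rewrite Nt0 mulr0 scaler0 scaleN1r oppr_ge0 pmulr_rle0//; apply => s sab.
  rewrite scaleN1r oppr_ge0 pmulr_rle0//.
  by have := NC s sab; rewrite ler_norml => /andP[_]; lra.
have := seg_D_ge0_le (mono C) _ tab t0ab (ltW tt0).
rewrite Nt0 mulr0 pmulr_rle0//; apply => s sab.
rewrite pmulr_rge0//.
by have := NC s sab; rewrite ler_norml => /andP[+ _]; lra.
Qed.

End LinearGrowth.

(** * Differentiability of inverse matrices *)

Section InverseMatrix.
Context {R : realType}.
Variables (a b : R).

Definition seg_diff {V : normedModType R} (f : R -> V) :=
  exists g, seg_D a b f g.

Lemma seg_diff_mxP m n (f : R -> 'M[R]_(m, n)) :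
  (forall i j, seg_diff (fun t => f t i j)) -> seg_diff f.
Proof.
move=> H.
have H' (ij : 'I_m * 'I_n) : exists g, seg_D a b (fun t => f t ij.1 ij.2) g.
  exact: H.
have [g Hg] := choice H'.
exists (fun t => \matrix_(i, j) g (i, j) t); apply/seg_D_mxP => i j.
by apply: seg_D_ext (Hg (i, j)) => t _ //; rewrite mxE.
Qed.

Lemma seg_diff_sum (I : finType) (f : I -> R -> R) :
  (forall i, seg_diff (f i)) -> seg_diff (fun t => \sum_i f i t).
Proof.
by move=> /choice[g Hg]; exists (fun t => \sum_i g i t); apply: seg_D_sum.
Qed.

Lemma seg_diff_mul (f g : R -> R) : seg_diff f -> seg_diff g ->
  seg_diff (fun t => f t * g t).
Proof. by move=> [f' Df] [g' Dg]; exists (fun t => f' t * g t + f t * g' t); apply: seg_D_mul. Qed.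

Lemma seg_diff_cst (c : R) : seg_diff (fun=> c).
Proof. by exists (fun=> 0); apply: seg_D_cst. Qed.

Lemma seg_diff_prod (I : Type) (r : seq I) (f : I -> R -> R) :
  (forall i, seg_diff (f i)) -> seg_diff (fun t => \prod_(i <- r) f i t).
Proof.
move=> D; elim: r => [|i r IH].
  under eq_fun do rewrite big_nil; exact: seg_diff_cst.
by under eq_fun do rewrite big_cons; apply: seg_diff_mul.
Qed.

Lemma seg_diff_trmx m n (A : R -> 'M[R]_(m, n)) :
  seg_diff A -> seg_diff (fun t => (A t)^T).
Proof. by move=> [A' /seg_D_trmx D]; exists (fun t => (A' t)^T). Qed.

Lemma seg_diff_det n (f : R -> 'M[R]_n) :
  (forall i j, seg_diff (fun t => f t i j)) -> seg_diff (fun t => \det (f t)).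
Proof.
move=> D; apply: seg_diff_sum => s.
by apply: seg_diff_mul; [exact: seg_diff_cst|exact: seg_diff_prod].
Qed.

(** Cramer's rule: the entries of the inverse are quotients of polynomials in
    the entries. *)
Lemma seg_diff_invmx n (f g : R -> 'M[R]_n) : seg_D a b f g ->
  (forall t, t \in `[a, b] -> f t \in unitmx) ->
  seg_diff (fun t => invmx (f t)).
Proof.
move=> /seg_D_mxP D fu; apply: seg_diff_mxP => i j.
have Df k l : seg_diff (fun t => f t k l) by exists (fun t => g t k l).
have [d' Dd] := seg_diff_det Df.
have d0 t : t \in `[a, b] -> \det (f t) != 0.
  by move=> /fu; rewrite unitmxE unitfE.
have Dadj : seg_diff (fun t => (\adj (f t)) i j).
  under eq_fun do rewrite mxE /cofactor.
  apply: seg_diff_mul; first exact: seg_diff_cst.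
  apply: seg_diff_det => k l; under eq_fun do rewrite !mxE; exact: Df.
have [h Dh] := seg_diff_mul (ex_intro _ _ (seg_D_inv Dd d0)) Dadj.
exists h; move: Dh; apply: seg_D_ext => t tab //.
by rewrite /invmx fu// [RHS]mxE.
Qed.

End InverseMatrix.

(** * The Lagrangian as a quadratic form *)

Section DotProduct.
Context {R : realType} {n : nat}.
Implicit Types (u v w : 'cV[R]_n).

Definition dot u v : R := (u^T *m v) 0 0.

Lemma dotE u v : dot u v = \sum_i u i 0 * v i 0.
Proof. by rewrite /dot mxE; apply: eq_bigr => i _; rewrite mxE. Qed.

Lemma dotC u v : dot u v = dot v u.
Proof. by rewrite !dotE; apply: eq_bigr => i _; rewrite mulrC. Qed.

Lemma dotDl u v w : dot (u + v) w = dot u w + dot v w.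
Proof. by rewrite /dot linearD mulmxDl mxE. Qed.

Lemma dotDr u v w : dot u (v + w) = dot u v + dot u w.
Proof. by rewrite /dot mulmxDr mxE. Qed.

Lemma dotZl c u v : dot (c *: u) v = c * dot u v.
Proof. by rewrite /dot linearZ -scalemxAl mxE. Qed.

Lemma dotZr c u v : dot u (c *: v) = c * dot u v.
Proof. by rewrite /dot -scalemxAr mxE. Qed.

Lemma dot0l v : dot 0 v = 0.
Proof. by rewrite /dot trmx0 mul0mx mxE. Qed.

Lemma dot0r v : dot v 0 = 0.
Proof. by rewrite /dot mulmx0 mxE. Qed.

Lemma dotNl u v : dot (- u) v = - dot u v.
Proof. by rewrite -scaleN1r dotZl mulN1r. Qed.

Lemma dotNr u v : dot u (- v) = - dot u v.
Proof. by rewrite -scaleN1r dotZr mulN1r. Qed.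

Lemma dotBr u v w : dot u (v - w) = dot u v - dot u w.
Proof. by rewrite dotDr dotNr. Qed.

Lemma dot_suml (I : Type) (r : seq I) (P : pred I) (f : I -> 'cV[R]_n) v :
  dot (\sum_(i <- r | P i) f i) v = \sum_(i <- r | P i) dot (f i) v.
Proof.
by elim/big_rec2 : _ => [|i x y _ <-]; rewrite ?dot0l ?dotDl.
Qed.

Lemma dot_sumr (I : Type) (r : seq I) (P : pred I) (f : I -> 'cV[R]_n) v :
  dot v (\sum_(i <- r | P i) f i) = \sum_(i <- r | P i) dot v (f i).
Proof.
by elim/big_rec2 : _ => [|i x y _ <-]; rewrite ?dot0r ?dotDr.
Qed.

Lemma dot_mulmxr u v (A : 'M[R]_n) : dot u (A *m v) = dot (A^T *m u) v.
Proof. by rewrite /dot trmx_mul trmxK mulmxA. Qed.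

Lemma dot_ge0 u : 0 <= dot u u.
Proof. by rewrite dotE sumr_ge0// => i _; rewrite -expr2 sqr_ge0. Qed.

Lemma dot_eq0 u : (dot u u == 0) = (u == 0).
Proof.
apply/eqP/eqP => [|->]; last by rewrite dot0l.
rewrite dotE => h; apply/colP => i; rewrite mxE.
have pos (j : 'I_n) : true -> 0 <= u j 0 * u j 0 by rewrite -expr2 sqr_ge0.
by have /eqP := psumr_eq0P pos h (i := i) isT; rewrite -expr2 sqrf_eq0 => /eqP.
Qed.

Lemma seg_D_dot a b (f f' g g' : R -> 'cV[R]_n) :
  seg_D a b f f' -> seg_D a b g g' ->
  seg_D a b (fun t => dot (f t) (g t))
            (fun t => dot (f' t) (g t) + dot (f t) (g' t)).
Proof.
move=> Df Dg; have /seg_D_mxP/(_ 0 0) := seg_D_mulmx (seg_D_trmx Df) Dg.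
by apply: seg_D_ext => t _ //; rewrite mxE.
Qed.

End DotProduct.

Section QuadraticLagrangian.
Context {R : realType}.
Variables (k n : nat) (Md Mo : nat -> R -> 'M[R]_n).
Implicit Types (t : R) (p q : nat -> 'cV[R]_n).

Notation L := (lagrangian k Md Mo).

(** Closed form of [lagrangian_grad] where the matrices [Md j t] are
    symmetric, see [lagrangian_gradE]. *)
Definition grad (j : nat) t q : 'cV[R]_n :=
  Md j t *m q j + (if (j < k)%N then Mo j t *m q j.+1 else 0)
  + (if (0 < j)%N then (Mo j.-1 t)^T *m q j.-1 else 0).

(** The bilinear form with [2 L t q = polar t q q], written through the
    gradient of [L] because this is the form in which integration by parts
    produces it.  It is symmetric when the [Md j t] are. *)
Definition polar t p q : R := \sum_(j < k.+1) dot (p j) (grad j t q).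

Lemma polarE t p q : polar t p q =
  \sum_(j < k.+1) dot (p j) (Md j t *m q j)
  + \sum_(j < k) (dot (p j) (Mo j t *m q j.+1) + dot (q j) (Mo j t *m p j.+1)).
Proof.
rewrite /polar /grad; under eq_bigr do rewrite !dotDr.
rewrite !big_split/= -addrA; congr (_ + (_ + _)).
  rewrite big_ord_recr/= ltnn dot0r addr0.
  by apply: eq_bigr => j _; rewrite ltn_ord.
rewrite big_ord_recl/= dot0r add0r.
by apply: eq_bigr => j _; rewrite dot_mulmxr trmxK dotC.
Qed.

Lemma lagrangian_polar t q : L t q = 2^-1 * polar t q q.
Proof.
rewrite polarE /lagrangian mulrDr; congr (2^-1 * _ + _).
  by apply: eq_bigr => j _; rewrite /dot mulmxA.
rewrite mulr_sumr; apply: eq_bigr => j _; rewrite /dot mulmxA; lra.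
Qed.

Lemma polarDl t p1 p2 q : polar t (fun j => p1 j + p2 j) q = polar t p1 q + polar t p2 q.
Proof. by rewrite -big_split; apply: eq_bigr => j _; rewrite dotDl. Qed.

Lemma polarZl t (c : R) p q : polar t (fun j => c *: p j) q = c * polar t p q.
Proof. by rewrite mulr_sumr; apply: eq_bigr => j _; rewrite dotZl. Qed.

Section Symmetric.
Variable t : R.
Hypothesis Mt_sym : forall j, (j <= k)%N -> (Md j t)^T = Md j t.

Lemma polarC p q : polar t p q = polar t q p.
Proof.
rewrite !polarE; congr (_ + _); apply: eq_bigr => j _; last by rewrite addrC.
by rewrite dot_mulmxr Mt_sym -1?ltnS// dotC.
Qed.

Lemma lagrangianD p q :
  L t (fun j => p j + q j) = L t p + polar t p q + L t q.
Proof.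
rewrite !lagrangian_polar polarDl [polar t p _]polarC [polar t q _]polarC.
by rewrite !polarDl [polar t q p]polarC; field.
Qed.

Lemma lagrangianZ (c : R) q : L t (fun j => c *: q j) = c ^+ 2 * L t q.
Proof. by rewrite !lagrangian_polar polarZl polarC polarZl; ring. Qed.

Definition at_index (i : nat) (v : 'cV[R]_n) : nat -> 'cV[R]_n :=
  fun j => if j == i then v else 0.

Lemma polar_at_index i v q : (i <= k)%N -> polar t (at_index i v) q = dot v (grad i t q).
Proof.
rewrite -ltnS => ik; rewrite /polar (bigD1 (Ordinal ik))//= /at_index eqxx.
rewrite big1 ?addr0// => j ji; rewrite ifF ?dot0l//; exact: negbTE.
Qed.

Lemma lagrangian_ext p q : (forall j, (j <= k)%N -> p j = q j) -> L t p = L t q.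
Proof.
move=> pq; congr (2^-1 * _ + _); apply: eq_bigr => j _.
  by rewrite !pq// -1?ltnS.
by rewrite !pq// ltnW.
Qed.

Lemma lagrangian_at_top v : L t (at_index k v) = 2^-1 * dot v (Md k t *m v).
Proof.
rewrite lagrangian_polar polar_at_index// /grad ltnn /at_index eqxx addr0 dotDr.
case: ifP => k0; last by rewrite dot0r addr0.
rewrite ifF ?mulmx0 ?dot0r ?addr0//; apply/negbTE.
by rewrite neq_ltn prednK ?leqnn.
Qed.

(** As [L] is quadratic, its difference quotient at [q] with step [h] in the
    direction [v] is [dot v (grad j t q)] plus [h] times [L] of [v]. *)
Lemma lagrangian_gradE j q : (j <= k)%N -> lagrangian_grad k Md Mo j t q = grad j t q.
Proof.
move=> jk; apply/colP => l; rewrite mxE.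
set v : 'cV[R]_n := delta_mx l 0.
have vE w : dot v w = w l 0.
  rewrite dotE (bigD1 l)//= big1 ?addr0 ?mxE ?eqxx ?mul1r// => i il.
  by rewrite mxE (negbTE il) mul0r.
rewrite -vE.
have h : (fun h => h^-1 *: (L t [eta q with j |-> h *: v + q j] -
    L t [eta q with j |-> q j])) @ 0^' --> dot v (grad j t q).
  have h1 : (fun h => dot v (grad j t q) + h * L t (at_index j v)) @ 0^' -->
      dot v (grad j t q) + 0 * L t (at_index j v).
    apply: cvgD; first exact: cvg_cst.
    apply: cvgM; last exact: cvg_cst.
    exact: cvg_within.
  rewrite mul0r addr0 in h1.
  apply: cvg_trans h1; apply: near_eq_cvg.
  exists 1 => //= h _ h0.
  have -> : L t [eta q with j |-> h *: v + q j] =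
     L t (fun i => h *: at_index j v i + q i).
    apply: lagrangian_ext => i _ /=; rewrite /at_index eq_sym.
    by case: eqP => [->|]//; rewrite scaler0 add0r.
  have -> : L t [eta q with j |-> q j] = L t q.
    by apply: lagrangian_ext => i _ /=; case: eqP => [->|].
  rewrite lagrangianD polarZl lagrangianZ polar_at_index// addrK /GRing.scale/=.
  by field.
apply/(cvg_lim _ h); exact: norm_hausdorff.
Qed.

End Symmetric.

End QuadraticLagrangian.

(** * Uniform bounds on the coefficients *)

Section MatrixBounds.
Context {R : realType}.

(** Young's inequality applied to every term of the double sum; the weight [e]
    makes the part charged to [v] as small as desired. *)
Lemma dot_mulmx_le n (A : 'M[R]_n) (K e : R) (u v : 'cV[R]_n) :
  0 < e -> (forall i j, `|A i j| <= K) ->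
  `|dot u (A *m v)| <= n%:R * (e * dot v v + K ^+ 2 / e * dot u u).
Proof.
move=> e0 AK.
rewrite dotE; apply: le_trans (ler_norm_sum _ _ _) _.
apply: (@le_trans _ _ (\sum_i \sum_j (e * v j 0 ^+ 2 + K ^+ 2 / e * u i 0 ^+ 2))).
  apply: ler_sum => i _; rewrite mxE mulr_sumr.
  apply: le_trans (ler_norm_sum _ _ _) _; apply: ler_sum => j _.
  have h : `|u i 0 * (A i j * v j 0)| <= `|u i 0| * (K * `|v j 0|).
    by rewrite !normrM ler_wpM2l// ler_wpM2r.
  apply: le_trans h _.
  rewrite -(real_normK (num_real (v j 0))) -(real_normK (num_real (u i 0))).
  set p := `|u i 0|; set q := `|v j 0|.
  have : 0 <= (e * q - K * p / 2) ^+ 2 / e by rewrite divr_ge0 ?sqr_ge0 ?ltW.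
  have -> : (e * q - K * p / 2) ^+ 2 / e =
     e * q ^+ 2 - p * (K * q) + K ^+ 2 / e * p ^+ 2 / 4.
    by field; rewrite gt_eqF.
  have : 0 <= K ^+ 2 / e * p ^+ 2.
    by rewrite mulr_ge0 ?sqr_ge0// divr_ge0 ?sqr_ge0// ltW.
  lra.
have vE (w : 'cV[R]_n) : \sum_j w j 0 ^+ 2 = dot w w.
  by rewrite dotE; apply: eq_bigr => j _; rewrite expr2.
under eq_bigr do rewrite big_split/= -mulr_sumr vE sumr_const card_ord.
rewrite big_split/= sumr_const card_ord sumrMnl -mulr_sumr vE mulrDr.
by rewrite !mulr_natl.
Qed.

Lemma seg_diff_mx_bounded m n a b (A : R -> 'M[R]_(m, n)) : seg_diff a b A ->
  exists2 K, 0 <= K & forall t, t \in `[a, b] -> forall i j, `|A t i j| <= K.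
Proof.
move=> [A' /seg_D_mxP D].
have [K HK] := choice (fun ij : 'I_m * 'I_n => seg_D_bounded (D ij.1 ij.2)).
exists (\sum_ij `|K ij|) => [|t tab i j]; first exact: sumr_ge0.
apply: le_trans (HK (i, j) t tab) _; apply: le_trans (ler_norm _) _.
by rewrite (bigD1 (i, j))//= lerDl sumr_ge0.
Qed.

Lemma posdefmx_unit n (A : 'M[R]_n) : posdefmx A -> A \in unitmx.
Proof.
move=> Apos; rewrite -row_free_unit -kermx_eq0; apply/rowV0P => v.
move=> /sub_kermxP vA; apply: contraTeq isT => v0.
have := Apos v^T; rewrite trmx_eq0 => /(_ v0).
by rewrite trmxK vA mul0mx mxE ltxx.
Qed.

(** The entries of the inverse of [A t] are bounded on the segment, hence
    [dot u v <= C * dot u u] for [v = invmx (A t) *m u].  Expanding the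
    nonnegative form [A t] at [u - C^-1 *: v] then gives the constant [C^-1]. *)
Lemma posdefmx_coercive n a b (A : R -> 'M[R]_n) : seg_diff a b A ->
  (forall t, t \in `[a, b] -> (A t)^T = A t) ->
  (forall t, t \in `[a, b] -> posdefmx (A t)) ->
  exists2 l, 0 < l &
    forall t, t \in `[a, b] -> forall u, l * dot u u <= dot u (A t *m u).
Proof.
move=> [A' DA] Asym Apos.
have Aunit t : t \in `[a, b] -> A t \in unitmx.
  by move=> tab; apply/posdefmx_unit/Apos.
have [K K0 HK] := seg_diff_mx_bounded (seg_diff_invmx DA Aunit).
pose C := n%:R * (1 + K ^+ 2) + 1.
have C0 : 0 < C.
  by rewrite ltr_wpDl// mulr_ge0// addr_ge0// sqr_ge0.
exists C^-1 => [|t tab u]; first by rewrite invr_gt0.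
pose v := invmx (A t) *m u.
have Av : A t *m v = u by rewrite mulKVmx// Aunit.
have uv : dot u v <= C * dot u u.
  apply: le_trans (ler_norm _) _.
  apply: le_trans (dot_mulmx_le _ _ ltr01 (HK t tab)) _.
  by rewrite divr1 -mulrDl mulrA /C mulrDl mul1r lerDl dot_ge0.
have : 0 <= dot (u - C^-1 *: v) (A t *m (u - C^-1 *: v)).
  have [->|w0] := eqVneq (u - C^-1 *: v) 0; first by rewrite dot0l.
  by have := Apos t tab _ w0; rewrite -mulmxA => /ltW.
rewrite mulmxBr -scalemxAr Av dotBr !dotDl !dotNl !dotZl !dotZr.
have -> : dot v (A t *m u) = dot u u by rewrite dot_mulmxr Asym// Av.
rewrite [dot v u]dotC => h.
have h2 : C^-1 * (C^-1 * dot u v) <= C^-1 * dot u u.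
  by rewrite ler_pM2l ?invr_gt0// ler_pdivrMl.
lra.
Qed.

End MatrixBounds.

(** * Extremals in Hamiltonian form *)

Section Extremals.
Context {R : realType}.
Variables (a b : R) (k n : nat) (Md Mo : nat -> R -> 'M[R]_n).
Implicit Types (x y p : nat -> R -> 'cV[R]_n).

Notation G := (grad k Md Mo).

Definition is_jet x := forall j, (j < k)%N -> seg_D a b (x j) (x j.+1).

(** The Jacobi equation as a first-order system: [p j.+1] is the momentum
    conjugate to [x j].  The condition on [p k] defines the top momentum, and
    with the convention that [p 0] is zero the equation for [j = 0] is the
    Jacobi equation itself, those for [j > 0] defining the lower momenta.
    No derivative of [x 0] of order higher than [k] appears. *)
Definition extremal x p :=
  [/\ is_jet x,
      forall t, t \in `[a, b] -> p 0%N t = 0,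
      forall t, t \in `[a, b] -> p k t = G k t (x^~ t)
    & forall j, (j < k)%N -> seg_D a b (p j.+1) (fun t => G j t (x^~ t) - p j t)].

(** The boundary term of Green's formula [seg_D_pairing]; its antisymmetric part
    is the canonical symplectic form on the space of jets and momenta. *)
Definition pairing x p (t : R) : R := \sum_(j < k) dot (x j t) (p j.+1 t).

(** Summation by parts: the terms [dot (x j) (p j)] cancel in pairs, except the
    last one. *)
Lemma pairing_telescope (x p g : nat -> 'cV[R]_n) : p 0%N = 0 ->
  \sum_(j < k) (dot (x j.+1) (p j.+1) + dot (x j) (g j - p j)) =
  \sum_(j < k) dot (x j) (g j) + dot (x k) (p k).
Proof.
move=> p0; under eq_bigr do rewrite dotBr addrCA.
rewrite big_split/=; congr (_ + _).
rewrite sumrB; apply/eqP; rewrite subr_eq; apply/eqP.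
rewrite [RHS]addrC -(big_ord_recr k (fun j => dot (x j) (p j))).
by rewrite big_ord_recl/= p0 dot0r add0r.
Qed.

Lemma seg_D_pairing y x p : is_jet y -> extremal x p ->
  seg_D a b (pairing y p) (fun t => polar k Md Mo t (y^~ t) (x^~ t)).
Proof.
move=> jy [_ p0 pk Dp].
have D : seg_D a b (pairing y p)
    (fun t => \sum_(j < k) (dot (y j.+1 t) (p j.+1 t)
                           + dot (y j t) (G j t (x^~ t) - p j t))).
  by apply: seg_D_sum => j _; apply: seg_D_dot; [exact: jy|exact: Dp].
apply: seg_D_ext D => // t tab.
rewrite (@pairing_telescope (y^~ t) (p^~ t) (fun j => G j t (x^~ t))) ?p0// pk//.
by rewrite /polar big_ord_recr.
Qed.

Lemma gradD j t (q1 q2 : nat -> 'cV[R]_n) :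
  G j t (fun i => q1 i + q2 i) = G j t q1 + G j t q2.
Proof.
have ifD (c : bool) (A : 'M[R]_n) (u v : 'cV[R]_n) :
    (if c then A *m (u + v) else 0) =
    (if c then A *m u else 0) + (if c then A *m v else 0).
  by case: c; rewrite ?mulmxDr ?addr0.
by rewrite /grad mulmxDr !ifD [RHS]addrACA; congr (_ + _); rewrite addrACA.
Qed.

Lemma gradZ j t (c : R) (q : nat -> 'cV[R]_n) :
  G j t (fun i => c *: q i) = c *: G j t q.
Proof.
by rewrite /grad; case: ifP => _; case: ifP => _; rewrite -!scalemxAr !scalerDr ?scaler0.
Qed.

Lemma grad_sum (I : Type) (r : seq I) j t (c : I -> R) (q : I -> nat -> 'cV[R]_n) :
  G j t (fun m => \sum_(i <- r) c i *: q i m) = \sum_(i <- r) c i *: G j t (q i).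
Proof.
elim: r => [|i r IH].
  have -> : (fun m => \sum_(i <- [::]) c i *: q i m) = (fun m => 0 *: (0 : 'cV[R]_n)).
    by apply/funext => m; rewrite big_nil scaler0.
  by rewrite gradZ scale0r big_nil.
rewrite big_cons -IH -gradZ -gradD; congr (G j t _).
by apply/funext => m; rewrite big_cons.
Qed.

Lemma is_jet_sum (I : Type) (r : seq I) (c : I -> R) (x : I -> nat -> R -> 'cV[R]_n) :
  (forall i, is_jet (x i)) ->
  is_jet (fun j t => \sum_(i <- r) c i *: x i j t).
Proof.
by move=> jx j jk; apply: seg_D_sum => i _; apply: seg_D_scalel; apply: jx.
Qed.

Lemma extremal_sum (I : Type) (r : seq I) (c : I -> R)
    (x p : I -> nat -> R -> 'cV[R]_n) :
  (forall i, extremal (x i) (p i)) ->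
  extremal (fun j t => \sum_(i <- r) c i *: x i j t)
           (fun j t => \sum_(i <- r) c i *: p i j t).
Proof.
move=> ex; split.
- by apply: is_jet_sum => i; have [] := ex i.
- by move=> t tab; rewrite big1// => i _; have [_ p0 _ _] := ex i; rewrite p0// scaler0.
- move=> t tab; rewrite grad_sum; apply: eq_bigr => i _.
  by have [_ _ pk _] := ex i; rewrite pk.
- move=> j jk.
  have D : seg_D a b (fun t => \sum_(i <- r) c i *: p i j.+1 t)
     (fun t => \sum_(i <- r) c i *: (G j t ((x i)^~ t) - p i j t)).
    by apply: seg_D_sum => i _; apply: seg_D_scalel; have [_ _ _] := ex i; apply.
  apply: seg_D_ext D => // t _; rewrite grad_sum -sumrB.
  by apply: eq_bigr => i _; rewrite scalerBr.
Qed.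

Hypothesis ab : a < b.
Hypothesis Md_sym : forall j, (j <= k)%N -> forall t, t \in `[a, b] ->
  (Md j t)^T = Md j t.

(** By Green's formula and the symmetry of [polar], the Wronskian
    [pairing x1 p2 - pairing x2 p1] is constant; it vanishes at [a].  In other
    words, the extremals with zero jet at [a] form a Lagrangian family. *)
Lemma pairing_sym x1 p1 x2 p2 : extremal x1 p1 -> extremal x2 p2 ->
  (forall j, (j < k)%N -> x1 j a = 0) -> (forall j, (j < k)%N -> x2 j a = 0) ->
  forall t, t \in `[a, b] -> pairing x1 p2 t = pairing x2 p1 t.
Proof.
move=> e1 e2 z1 z2 t tab; have [j1 _ _ _] := e1; have [j2 _ _ _] := e2.
have z x p : (forall j, (j < k)%N -> x j a = 0) -> pairing x p a = 0.
  by move=> z; rewrite /pairing big1// => j _; rewrite z// dot0l.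
pose W s := pairing x1 p2 s + (-1) *: pairing x2 p1 s.
have D : seg_D a b W (fun=> 0).
  have := seg_D_add (seg_D_pairing j1 e2) (seg_D_scalel (c := -1) (seg_D_pairing j2 e1)).
  apply: seg_D_ext => // s sab; rewrite scaleN1r polarC ?subrr// => j jk.
  exact: Md_sym.
have aab : a \in `[a, b] by rewrite in_itv /= lexx ltW.
have cst := seg_D_eq0_cst (ltW ab) D (fun _ _ => erefl).
have := cst t tab; rewrite -(cst a aab) /W !scaleN1r !z// subr0 => /eqP.
by rewrite subr_eq0 => /eqP.
Qed.

Section Uniqueness.
Hypothesis Md_diff : forall j, (j <= k)%N -> seg_diff a b (Md j).
Hypothesis Mo_diff : forall j, (j < k)%N -> seg_diff a b (Mo j).
Hypothesis Mk_unit : forall t, t \in `[a, b] -> Md k t \in unitmx.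

Definition dominated (S : R -> R) (u : R -> 'cV[R]_n) := exists2 K, 0 <= K &
  forall t, t \in `[a, b] -> forall l, `|u t l 0| <= K * S t.

Lemma dominatedD S u v : dominated S u -> dominated S v ->
  dominated S (fun t => u t + v t).
Proof.
move=> [K1 K10 H1] [K2 K20 H2]; exists (K1 + K2) => [|t tab l]; first exact: addr_ge0.
rewrite mxE mulrDl; apply: le_trans (ler_normD _ _) _.
by rewrite lerD ?H1 ?H2.
Qed.

Lemma dominatedN S u : dominated S u -> dominated S (fun t => - u t).
Proof. by move=> [K K0 H]; exists K => // t tab l; rewrite mxE normrN H. Qed.

Lemma dominated_mulmx S (A : R -> 'M[R]_n) u : seg_diff a b A ->
  dominated S u -> dominated S (fun t => A t *m u t).
Proof.
move=> /seg_diff_mx_bounded[C C0 HC] [K K0 H].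
exists (\sum_(l < n) C * K) => [|t tab i].
  by apply: sumr_ge0 => l _; rewrite mulr_ge0.
rewrite mxE mulr_suml; apply: le_trans (ler_norm_sum _ _ _) _.
by apply: ler_sum => l _; rewrite normrM -mulrA ler_pM ?HC ?H.
Qed.

Lemma dominated_ext S u v : {in `[a, b], u =1 v} -> dominated S u -> dominated S v.
Proof. by move=> uv [K K0 H]; exists K => // t tab l; rewrite -uv// H. Qed.

(** The phase [(x 0, ..., x (k - 1), p 1, ..., p k)] solves a first-order linear
    system with bounded coefficients, because [x k] is a function of [p k] and
    [x (k - 1)] by the invertibility of [Md k]. *)
Lemma extremal_eq0 x p t0 : extremal x p -> t0 \in `[a, b] ->
  (forall j, (j < k)%N -> x j t0 = 0) -> (forall j, (j < k)%N -> p j.+1 t0 = 0) ->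
  forall j t, (j < k)%N -> t \in `[a, b] -> x j t = 0.
Proof.
move=> [jx p0 pk Dp] t0ab x0 q0 j t jk tab.
pose I := (bool * ('I_k * 'I_n))%type.
pose v (i : I) s : R := if i.1 then x i.2.1 s i.2.2 0 else p i.2.1.+1 s i.2.2 0.
pose v' (i : I) s : R := if i.1 then x i.2.1.+1 s i.2.2 0
  else (G i.2.1 s (x^~ s) - p i.2.1 s) i.2.2 0.
pose S s := \sum_i `|v i s|.
have vS (i : I) s : `|v i s| <= 1 * S s.
  by rewrite mul1r /S (bigD1 i)//= lerDl sumr_ge0.
have dx i : (i < k)%N -> dominated S (x i).
  move=> ik; exists 1 => // s sab l; exact: (vS (true, (Ordinal ik, l))).
have dp i : (i < k)%N -> dominated S (p i.+1).
  move=> ik; exists 1 => // s sab l; exact: (vS (false, (Ordinal ik, l))).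
have dp' i : (i <= k)%N -> dominated S (p i).
  case: i => [_|i]; last exact: dp.
  by exists 0 => // s sab l; rewrite p0// mxE normr0 mul0r.
have dsub i : (i <= k)%N -> dominated S (fun t => if (0 < i)%N
    then (Mo i.-1 t)^T *m x i.-1 t else 0).
  case: i => [_|i ik] /=.
    by exists 0 => // s sab l; rewrite mxE normr0 mul0r.
  by apply: dominated_mulmx (dx _ ik); apply/seg_diff_trmx/Mo_diff.
have dxk : dominated S (x k).
  have d : dominated S (fun s => invmx (Md k s) *m (p k s - (if (0 < k)%N
    then (Mo k.-1 s)^T *m x k.-1 s else 0))).
    apply: dominated_mulmx.
      by have [A' DA] := Md_diff (leqnn k); apply: seg_diff_invmx DA Mk_unit.
    by apply: dominatedD (dp' _ (leqnn k)) _; apply/dominatedN/dsub.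
  apply: dominated_ext d => s sab.
  by rewrite pk// /grad ltnn addr0 addrK mulKmx// Mk_unit.
have dx' i : (i <= k)%N -> dominated S (x i).
  by rewrite leq_eqVlt => /predU1P[->|/dx].
have dG i : (i < k)%N -> dominated S (fun s => G i s (x^~ s) - p i s).
  move=> ik; apply: dominatedD; last by apply/dominatedN/dp'/ltnW.
  apply: dominatedD; last exact/dsub/ltnW.
  apply: dominatedD.
    by apply: dominated_mulmx; [exact/Md_diff/ltnW|exact/dx].
  by rewrite ik; apply: dominated_mulmx; [exact/Mo_diff|exact/dx'].
have dv' (i : I) : exists K, 0 <= K /\
    forall s, s \in `[a, b] -> `|v' i s| <= K * S s.
  case: i => -[] [i l]; rewrite /v' /=.
    by have [K K0 H] := dx' _ (ltn_ord i); exists K; split => // s sab; apply: H.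
  by have [K K0 H] := dG _ (ltn_ord i); exists K; split => // s sab; apply: H.
have [K HK] := choice dv'.
have Dv i : seg_D a b (v i) (v' i).
  case: i => -[] [i l]; rewrite /v /v' /=.
    by have /seg_D_mxP := jx i (ltn_ord i); apply.
  by have /seg_D_mxP := Dp i (ltn_ord i); apply.
apply/colP => l; rewrite mxE.
have K0 : 0 <= \sum_i K i by apply: sumr_ge0 => i _; have [] := HK i.
apply: (linear_growth_eq0 K0 Dv _ t0ab _ (true, (Ordinal jk, l)) tab).
  move=> s i sab; have [Ki H] := HK i; apply: le_trans (H s sab) _.
  apply: ler_wpM2r; first exact: sumr_ge0.
  by rewrite (bigD1 i)//= lerDl sumr_ge0// => i' _; have [] := HK i'.
by case=> -[] [i m]; rewrite /v /= ?x0 ?q0 ?mxE.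
Qed.

End Uniqueness.
End Extremals.

Section Restriction.
Context {R : realType}.

Lemma is_jet_sub n k a b a' b' (y : nat -> R -> 'cV[R]_n) :
  a <= a' -> b' <= b -> is_jet a b k y -> is_jet a' b' k y.
Proof. by move=> aa bb jy j jk; apply: seg_D_sub (jy j jk). Qed.

Lemma extremal_subseg n k a b a' b' (Md Mo : nat -> R -> 'M[R]_n) x p :
  a <= a' -> b' <= b -> extremal a b k Md Mo x p -> extremal a' b' k Md Mo x p.
Proof.
move=> aa bb [jx p0 pk Dp]; split.
- exact: is_jet_sub jx.
- by move=> t /(itv_cc_sub aa bb)/p0.
- by move=> t /(itv_cc_sub aa bb)/pk.
- by move=> j jk; apply: seg_D_sub (Dp j jk).
Qed.

End Restriction.

(** * Jacobi solutions are extremals *)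

Section IteratedDerivatives.
Context {R : realType}.
Variables (a b : R).
Hypothesis ab : a < b.

Notation nder := (seg_nderivable a b).

Section Normed.
Context {V : normedModType R}.
Implicit Types f g : R -> V.

Lemma seg_D_derivn m j f : nder m f -> (j < m)%N ->
  seg_D a b (seg_derivn a b j f) (seg_derivn a b j.+1 f).
Proof. by move=> nf jm; apply: derivable_seg_D => t; apply: nf. Qed.

Lemma seg_derivnSr j f : seg_derivn a b j.+1 f = seg_derivn a b j (seg_deriv a b f).
Proof. exact: iterSr. Qed.

Lemma seg_nderivable_leq m1 m2 f : (m1 <= m2)%N -> nder m2 f -> nder m1 f.
Proof. by move=> m12 nf j jm; apply: nf; apply: leq_trans m12. Qed.

Lemma seg_nderivable_derivn m j f : nder (j + m) f -> nder m (seg_derivn a b j f).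
Proof.
move=> nf i im; have -> : seg_derivn a b i (seg_derivn a b j f) = seg_derivn a b (i + j) f.
  by rewrite /seg_derivn iterD.
by apply: nf; rewrite addnC ltn_add2l.
Qed.

(** Derivatives relative to the segment see only the values on the segment, so
    agreement there is inherited by all the iterated derivatives. *)
Lemma seg_nderivable_ext m f g : {in `[a, b], f =1 g} -> nder m f ->
  nder m g /\
  forall j, (j <= m)%N -> {in `[a, b], seg_derivn a b j f =1 seg_derivn a b j g}.
Proof.
elim: m f g => [|m IH] f g fg nf.
  by split=> // j; rewrite leqn0 => /eqP ->.
have Df : seg_D a b f (seg_deriv a b f) := seg_D_derivn nf (ltn0Sn m).
have Dg : seg_D a b g (seg_deriv a b f) by apply: seg_D_ext Df.
have fg' : {in `[a, b], seg_deriv a b f =1 seg_deriv a b g}.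
  by move=> t tab; rewrite (seg_D_derivE ab Dg).
have nf' : nder m (seg_deriv a b f) by apply: (@seg_nderivable_derivn m 1).
have [ng' eq] := IH _ _ fg' nf'; split.
  case=> [_|j jm] t tab; first exact: seg_D_derivable Dg tab.
  by rewrite seg_derivnSr; apply: ng'.
by case=> [|j jm] //; rewrite !seg_derivnSr; apply: eq.
Qed.

Lemma seg_D_nderivable m f g : seg_D a b f g -> nder m g -> nder m.+1 f.
Proof.
move=> D ng.
have fg : {in `[a, b], g =1 seg_deriv a b f}.
  by move=> t tab; rewrite (seg_D_derivE ab D).
have [nf' _] := seg_nderivable_ext fg ng.
case=> [_|j jm] t tab; first exact: seg_D_derivable D tab.
by rewrite seg_derivnSr; apply: nf'.
Qed.

Lemma seg_nderivableD m f g : nder m f -> nder m g -> nder m (fun t => f t + g t).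
Proof.
elim: m f g => [|m IH] f g nf ng //.
apply: seg_D_nderivable (seg_D_add (seg_D_derivn nf (ltn0Sn m)) (seg_D_derivn ng (ltn0Sn m))) _.
by apply: IH; apply: (@seg_nderivable_derivn m 1).
Qed.

End Normed.

Lemma seg_nderivable_mulmx m n1 n2 n3 (A : R -> 'M[R]_(n1, n2)) (B : R -> 'M[R]_(n2, n3)) :
  nder m A -> nder m B -> nder m (fun t => A t *m B t).
Proof.
elim: m A B => [|m IH] A B nA nB //.
apply: seg_D_nderivable (seg_D_mulmx (seg_D_derivn nA (ltn0Sn m)) (seg_D_derivn nB (ltn0Sn m))) _.
apply: seg_nderivableD; apply: IH.
- exact: (@seg_nderivable_derivn _ m 1).
- exact: seg_nderivable_leq nB.
- exact: seg_nderivable_leq nA.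
- exact: (@seg_nderivable_derivn _ m 1).
Qed.

Lemma seg_nderivable_trmx m n1 n2 (A : R -> 'M[R]_(n1, n2)) :
  nder m A -> nder m (fun t => (A t)^T).
Proof.
elim: m A => [|m IH] A nA //.
apply: seg_D_nderivable (seg_D_trmx (seg_D_derivn nA (ltn0Sn m))) _.
by apply: IH; apply: (@seg_nderivable_derivn _ m 1).
Qed.

Lemma seg_smooth_diff (V : normedModType R) (f : R -> V) : seg_smooth a b f -> seg_diff a b f.
Proof. by move=> sf; exists (seg_deriv a b f); exact: (seg_D_derivn (sf 1%N) (ltn0Sn 0)). Qed.

(** The iterated derivatives of a matrix function are those of its rows only
    where the rows are differentiable, since otherwise both sides are arbitrary
    limits. *)
Lemma seg_derivn_row N n m (h : 'I_N -> R -> 'cV[R]_n) j i l t :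
  (forall i, nder m (h i)) -> (j <= m)%N -> t \in `[a, b] ->
  seg_derivn a b j (solution_mx h) t i l = seg_derivn a b j (h i) t l 0.
Proof.
move=> nh jm.
suff: {in `[a, b], seg_derivn a b j (solution_mx h) =1
        fun t => \matrix_(i < N, l < n) seg_derivn a b j (h i) t l 0}.
  by move=> E tab; rewrite E// mxE.
elim: j jm => [|j IH] jm s sab //.
have D : seg_D a b (fun t => \matrix_(i < N, l < n) seg_derivn a b j (h i) t l 0)
     (fun t => \matrix_(i < N, l < n) seg_derivn a b j.+1 (h i) t l 0).
  apply/seg_D_mxP => i' l'.
  have /seg_D_mxP/(_ l' 0) := seg_D_derivn (nh i') jm.
  by apply: seg_D_ext => u _ //; rewrite mxE.
have D' : seg_D a b (seg_derivn a b j (solution_mx h)) (fun t =>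
    \matrix_(i < N, l < n) seg_derivn a b j.+1 (h i) t l 0).
  by apply: seg_D_ext D => // u uab; rewrite IH// ltnW.
exact: (seg_D_derivE ab D' sab).
Qed.

End IteratedDerivatives.

Section JacobiSolutions.
Context {R : realType}.
Variables (a b : R) (k n : nat) (Md Mo : nat -> R -> 'M[R]_n).
Hypothesis ab : a < b.
Hypothesis Md_smooth : forall i, (i <= k)%N -> seg_smooth a b (Md i).
Hypothesis Mo_smooth : forall i, (i < k)%N -> seg_smooth a b (Mo i).
Hypothesis Md_sym : forall j, (j <= k)%N -> forall t, t \in `[a, b] ->
  (Md j t)^T = Md j t.
Variable h : R -> 'cV[R]_n.
Hypothesis h_sol : jacobi_solution a b k Md Mo h.

Let x j := seg_derivn a b j h.

Let g l s := lagrangian_grad k Md Mo l s (jet a b h s).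

Lemma lagrangian_grad_jet l : (l <= k)%N ->
  {in `[a, b], g l =1 fun s => grad k Md Mo l s (x^~ s)}.
Proof.
by move=> lk s sab; rewrite /g lagrangian_gradE// => j jk; apply: Md_sym.
Qed.

(** The gradient in [q l] involves derivatives of [h] up to the order [l + 1] if
    [l < k] and up to the order [k] if [l = k]: [l] more differentiations stay
    within the [2 k] available ones. *)
Lemma grad_jet_nderivable l : (l <= k)%N -> seg_nderivable a b l (g l).
Proof.
move=> lk; have [nh _] := h_sol.
have nx j m : (j + m <= 2 * k)%N -> seg_nderivable a b m (x j).
  by move=> jm; apply: seg_nderivable_derivn; apply: seg_nderivable_leq nh.
have : seg_nderivable a b l (fun s => grad k Md Mo l s (x^~ s)).
  have n0 : seg_nderivable a b l (fun=> 0 : 'cV[R]_n).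
    elim: l {lk} => [|m IH] //; apply: (seg_D_nderivable ab _ IH).
    exact: seg_D_cst.
  have nA : seg_nderivable a b l (fun s => Md l s *m x l s).
    apply: (seg_nderivable_mulmx ab); first exact: Md_smooth.
    by apply: nx; rewrite addnn mul2n leq_double.
  have nB : seg_nderivable a b l
      (fun s => if (l < k)%N then Mo l s *m x l.+1 s else 0).
    case: (ltnP l k) => [lk'|_]; last exact: n0.
    apply: (seg_nderivable_mulmx ab); first exact: Mo_smooth.
    by apply: nx; rewrite addSn -addnS mul2n -addnn leq_add.
  have nC : seg_nderivable a b l
      (fun s => if (0 < l)%N then (Mo l.-1 s)^T *m x l.-1 s else 0).
    case: (ltnP 0 l) => [l0|_]; last exact: n0.
    apply: (seg_nderivable_mulmx ab).
      by apply: (seg_nderivable_trmx ab); apply: Mo_smooth; rewrite prednK.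
    apply: nx; rewrite mul2n -addnn leq_add//.
    by apply: leq_trans lk; apply: leq_pred.
  exact: (seg_nderivableD ab (seg_nderivableD ab nA nB) nC).
have e : {in `[a, b], (fun s => grad k Md Mo l s (x^~ s)) =1 g l}.
  by move=> s sab; rewrite lagrangian_grad_jet.
by move=> ng; have [] := seg_nderivable_ext ab e ng.
Qed.

(** Ostrogradsky's momenta. *)
Definition momentum j t : 'cV[R]_n :=
  \sum_(i < (k - j).+1) (-1) ^+ i *: seg_derivn a b i (g (j + i)) t.

(** Shifting the index in the alternating sum [momentum] gives the equation for
    the derivative of [momentum j.+1]; [momentum 0] is the Jacobi operator. *)
Lemma jacobi_extremal : extremal a b k Md Mo x momentum.
Proof.
have [nh h0] := h_sol; split.
- move=> j jk; apply: seg_D_derivn nh _.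
  by rewrite (leq_trans jk)// mul2n -addnn leq_addr.
- by move=> t tab; rewrite -(h0 t tab) /momentum /jacobi_operator subn0.
- move=> t tab; rewrite /momentum subnn big_ord1 expr0 scale1r addn0 /=.
  exact: lagrangian_grad_jet.
move=> j jk.
have D : seg_D a b (momentum j.+1)
   (fun t => \sum_(i < k - j) (-1) ^+ i *: seg_derivn a b i.+1 (g (j.+1 + i)) t).
  rewrite /momentum subnSK//.
  apply: seg_D_sum => i _; apply: seg_D_scalel.
  have ik : (j.+1 + i <= k)%N by rewrite addSn -ltn_subRL.
  apply: seg_D_derivn (grad_jet_nderivable ik) _.
  by rewrite addSn ltnS leq_addl.
apply: seg_D_ext D => // t tab.
rewrite /momentum big_ord_recl /= expr0 scale1r addn0 lagrangian_grad_jet 1?ltnW//.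
rewrite opprD addrA subrr add0r -sumrN; apply: eq_bigr => i _.
by rewrite /bump /= add1n exprS mulN1r scaleNr opprK addSnnS.
Qed.

End JacobiSolutions.

(** * Invertible frames of extremals *)

Section Frames.
Context {R : realType}.

(** The columns are indexed by [mxvec_index j l], so that for [k * n] sequences
    this is a square matrix; the width [\sum_(j < k) n] of a [\mxrow] is
    only provably equal to [k * n]. *)
Definition stack_mx N k n (x : 'I_N -> nat -> R -> 'cV[R]_n) (t : R) : 'M[R]_(N, k * n) :=
  \matrix_(i < N) mxvec (\matrix_(j < k, l < n) x i j t l 0).

Lemma stack_mxE N k n (x : 'I_N -> nat -> R -> 'cV[R]_n) t i j l :
  stack_mx k x t i (mxvec_index j l) = x i j t l 0.
Proof.
have -> : stack_mx k x t i (mxvec_index j l) = row i (stack_mx k x t) 0 (mxvec_index j l).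
  by rewrite [RHS]mxE.
by rewrite rowK mxvecE mxE.
Qed.

Lemma mulmx_stack N k n (x : 'I_N -> nat -> R -> 'cV[R]_n) t (v : 'rV[R]_N) (j : 'I_k) l :
  (v *m stack_mx k x t) 0 (mxvec_index j l) = (\sum_i v 0 i *: x i j t) l 0.
Proof.
by rewrite mxE summxE; apply: eq_bigr => i _; rewrite stack_mxE mxE.
Qed.

Lemma stack_colspan N k n (D : 'I_k -> 'M[R]_(N, n)) (x : 'I_N -> nat -> R -> 'cV[R]_n) t
    (d : 'cV[R]_(k * n)) :
  (forall j i l, D j i l = x i j t l 0) ->
  stack_mx k x t *m d \in colspan (\mxrow_(j < k) D j).
Proof.
move=> Dx; have -> : stack_mx k x t *m d = \sum_r d r 0 *: col r (stack_mx k x t).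
  apply/colP => i; rewrite mxE summxE; apply: eq_bigr => c _.
  by rewrite !mxE mulrC.
apply: memv_suml => r _; apply: memvZ; case/mxvec_indexP: r => j l.
suff -> : col (mxvec_index j l) (stack_mx k x t) = col (tagnat.Rank j l) (\mxrow_(j < k) D j).
  by apply/memv_span/map_f; exact: mem_enum.
have -> : col (tagnat.Rank j l) (\mxrow_(j < k) D j) = col l (submxrow (\mxrow_(j < k) D j) j).
  by apply/colP => i; rewrite !mxE.
by rewrite mxrowK; apply/colP => i; rewrite mxE stack_mxE mxE Dx.
Qed.

Variables (a b : R) (k n : nat) (Md Mo : nat -> R -> 'M[R]_n).
Hypothesis ab : a < b.
Hypothesis k0 : (0 < k)%N.
Hypothesis Md_diff : forall j, (j <= k)%N -> seg_diff a b (Md j).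
Hypothesis Mo_diff : forall j, (j < k)%N -> seg_diff a b (Mo j).
Hypothesis Mk_unit : forall t, t \in `[a, b] -> Md k t \in unitmx.

Variables x p : 'I_(k * n + k * n) -> nat -> R -> 'cV[R]_n.
Hypothesis xp : forall i, extremal a b k Md Mo (x i) (p i).
Hypothesis x_free : forall d : 'I_(k * n + k * n) -> R,
  (forall t, t \in `[a, b] -> \sum_i d i *: x i 0%N t = 0) -> forall i, d i = 0.

(** A linear relation between the rows is a combination of the extremals whose
    phase vanishes at [t].  This combination is identically zero by
    [extremal_eq0], so the relation is trivial by linear independence. *)
Lemma phase_mx_unit t : t \in `[a, b] ->
  row_mx (stack_mx k x t) (stack_mx k (fun i j => p i j.+1) t) \in unitmx.
Proof.
move=> tab; rewrite -row_free_unit -kermx_eq0; apply/rowV0P => v /sub_kermxP vZ.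
have [vx vp] : v *m stack_mx k x t = 0 /\
    v *m stack_mx k (fun i j => p i j.+1) t = 0.
  by apply/eq_row_mx; rewrite -mul_mx_row vZ row_mx0.
have ex := extremal_sum (index_enum _) (v 0) xp.
have zero (y : 'I_(k * n + k * n) -> nat -> R -> 'cV[R]_n) :
  v *m stack_mx k y t = 0 -> forall j, (j < k)%N -> \sum_i v 0 i *: y i j t = 0.
  move=> vy j jk; apply/colP => l.
  by rewrite -(mulmx_stack y t v (Ordinal jk)) vy !mxE.
apply/rowP => i; rewrite mxE; apply: (@x_free (v 0) _ i) => s sab.
exact: (extremal_eq0 Md_diff Mo_diff Mk_unit ex tab (zero _ vx) (zero _ vp) k0 sab).
Qed.

(** If [d] is in the kernel of the upper half of the stacked jets, the
    combination of all the columns with coefficients [d] lies in the Jacobi curve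
    and in the vertical space, so it is zero.  As the columns of the phase
    matrix are independent, [d = 0]. *)
Lemma frame_unit t (D : 'I_k -> 'M[R]_(k * n + k * n, n)) : t \in `[a, b] ->
  (forall j i l, D j i l = x i j t l 0) ->
  (colspan (\mxrow_(j < k) D j) :&: vertical_space (k * n) (k * n) = 0)%VS ->
  stack_mx k (fun i => x (lshift (k * n) i)) t \in unitmx.
Proof.
move=> tab Dx cap0.
have -> : stack_mx k (fun i => x (lshift (k * n) i)) t = usubmx (stack_mx k x t).
  apply/matrixP => i r; case/mxvec_indexP: r => j l.
  by rewrite stack_mxE [RHS]mxE stack_mxE.
rewrite -unitmx_tr -row_free_unit -kermx_eq0; apply/rowV0P => v /sub_kermxP.
move=> /(congr1 trmx); rewrite trmx_mul trmxK trmx0 => Xv.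
set w := stack_mx k x t *m v^T.
have : w \in (colspan (\mxrow_(j < k) D j) :&: vertical_space (k * n) (k * n))%VS.
  rewrite memv_cap stack_colspan//= memv_ker lfunE /=.
  by rewrite -mul_usub_mx Xv.
rewrite cap0 memv0 => /eqP w0.
have : row_mx (stack_mx k x t) (stack_mx k (fun i j => p i j.+1) t) *m col_mx v^T 0 = 0.
  by rewrite mul_row_col mulmx0 addr0.
move/(congr1 (mulmx (invmx (row_mx (stack_mx k x t) (stack_mx k (fun i j => p i j.+1) t))))).
rewrite mulKmx ?phase_mx_unit// mulmx0 -col_mx0 => /eq_col_mx[v0 _].
by rewrite -[v]trmxK v0 trmx0.
Qed.

End Frames.

(** * Picone's identity *)

Section Picone.
Context {R : realType}.

Lemma seg_D_stack N k n a b (x x' : 'I_N -> nat -> R -> 'cV[R]_n) :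
  (forall i j, (j < k)%N -> seg_D a b (x i j) (x' i j)) ->
  seg_D a b (stack_mx k x) (stack_mx k x').
Proof.
move=> D; apply/seg_D_mxP => i r; case/mxvec_indexP: r => j l.
have /seg_D_mxP/(_ l 0) := D i j (ltn_ord j).
by apply: seg_D_ext => t _; rewrite stack_mxE.
Qed.

Variables (s b : R) (k n : nat) (Md Mo : nat -> R -> 'M[R]_n).
Hypothesis sb : s < b.
Hypothesis k0 : (0 < k)%N.
Hypothesis Md_sym : forall j, (j <= k)%N -> forall t, t \in `[s, b] ->
  (Md j t)^T = Md j t.
Variables x p : 'I_(k * n) -> nat -> R -> 'cV[R]_n.
Hypothesis xp : forall i, extremal s b k Md Mo (x i) (p i).
Hypothesis xp_sym : forall i j t, t \in `[s, b] ->
  pairing k (x i) (p j) t = pairing k (x j) (p i) t.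
Hypothesis x_unit : forall t, t \in `[s, b] -> stack_mx k x t \in unitmx.
Variable y : nat -> R -> 'cV[R]_n.
Hypothesis y_jet : is_jet s b k y.

(** Variation of constants: the coefficients of [y] at the time [t] in the
    moving frame. *)
Definition frame_coef t : 'rV[R]_(k * n) :=
  stack_mx k (fun _ : 'I_1 => y) t *m invmx (stack_mx k x t).

Notation c := frame_coef.

Lemma frame_coefP j t : (j < k)%N -> t \in `[s, b] ->
  y j t = \sum_i c t 0 i *: x i j t.
Proof.
move=> jk tsb; apply/colP => l.
by rewrite -(mulmx_stack x t (c t) (Ordinal jk)) mulmxKV ?x_unit// stack_mxE.
Qed.

Lemma seg_diff_frame_coef : exists c' : 'I_(k * n) -> R -> R,
  forall i, seg_D s b (fun t => c t 0 i) (c' i).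
Proof.
have DX : seg_D s b (stack_mx k x) (stack_mx k (fun i j => x i j.+1)).
  by apply: seg_D_stack => i j jk; have [jx _ _ _] := xp i; apply: jx.
have [Y' DY] := seg_diff_invmx DX x_unit.
have DE : seg_D s b (stack_mx k (fun _ : 'I_1 => y)) (stack_mx k (fun _ j => y j.+1)).
  by apply: seg_D_stack => _ j jk; apply: y_jet.
have /seg_D_mxP D := seg_D_mulmx DE DY.
by eexists => i; apply: (D 0 i).
Qed.

(** Write [y j = \sum_i c_i x_i j] for [j < k] with [c = frame_coef], and let
    [z], [r] be the jets and momenta combined with the same coefficients, [z k]
    included.  The derivatives of the [c_i] contribute to [y j.+1] only for
    [j = k - 1], by the vector [w = y k - z k].  When [pairing y r] is
    differentiated, the symmetry [xp_sym] turns the contribution of the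
    derivatives of the [c_i] in [r] into [dot w (r k)], and what is missing to
    twice the Lagrangian is exactly the square [dot w (Md k *m w)].  If [w] is
    zero the [c_i] have zero derivatives, because the frame is invertible. *)
Lemma picone : exists F F' w,
  [/\ seg_D s b F F',
      forall t, t \in `[s, b] ->
        F t = 2^-1 * pairing k y (fun j u => \sum_i c u 0 i *: p i j u) t,
      forall t, t \in `[s, b] ->
        lagrangian k Md Mo t (y^~ t) = F' t + 2^-1 * dot (w t) (Md k t *m w t)
    & (forall t, t \in `]s, b[ -> w t = 0) -> forall t, t \in `[s, b] -> c t = c b].
Proof.
have [c' Dc] := seg_diff_frame_coef.
pose z j t := \sum_i c t 0 i *: x i j t.
pose r j t := \sum_i c t 0 i *: p i j t.
pose dz j t := \sum_i c' i t *: x i j t.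
pose dr j t := \sum_i c' i t *: p i j t.
pose w t := y k t - z k t.
pose G j t := grad k Md Mo j t (z^~ t).
have Gz j t : G j t = \sum_i c t 0 i *: grad k Md Mo j t ((x i)^~ t).
  exact: grad_sum.
have r0 t : t \in `[s, b] -> r 0%N t = 0.
  by move=> tsb; rewrite /r big1// => i _; have [_ -> // _ _] := xp i; rewrite scaler0.
have rk t : t \in `[s, b] -> r k t = G k t.
  move=> tsb; rewrite Gz; apply: eq_bigr => i _.
  by have [_ _ pk _] := xp i; rewrite pk.
have yz j t : (j < k)%N -> t \in `[s, b] -> y j t = z j t.
  by move=> jk tsb; rewrite frame_coefP.
have Dz j : (j < k)%N -> seg_D s b (z j) (fun t => dz j t + z j.+1 t).
  move=> jk; have : seg_D s b (z j)
      (fun t => \sum_i (c' i t *: x i j t + c t 0 i *: x i j.+1 t)).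
    apply: seg_D_sum => i _; apply: seg_D_scale; first exact: Dc.
    by have [jx _ _ _] := xp i; apply: jx.
  by apply: seg_D_ext => t tsb //; rewrite big_split.
have Dr j : (j < k)%N -> seg_D s b (r j.+1) (fun t => dr j.+1 t + (G j t - r j t)).
  move=> jk; have : seg_D s b (r j.+1)
      (fun t => \sum_i (c' i t *: p i j.+1 t
         + c t 0 i *: (grad k Md Mo j t ((x i)^~ t) - p i j t))).
    apply: seg_D_sum => i _; apply: seg_D_scale; first exact: Dc.
    by have [_ _ _ Dp] := xp i; apply: Dp.
  apply: seg_D_ext => t tsb //; rewrite big_split/= Gz -sumrB; congr (_ + _).
  by apply: eq_bigr => i _; rewrite scalerBr.
have yS j t : (j < k)%N -> t \in `[s, b] -> y j.+1 t = dz j t + z j.+1 t.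
  move=> jk tsb; have D : seg_D s b (y j) (fun t => dz j t + z j.+1 t).
    by apply: seg_D_ext (Dz j jk) => // u usb; rewrite yz.
  exact: (seg_D_unique sb (y_jet jk) D tsb).
have dz0 j t : (j.+1 < k)%N -> t \in `[s, b] -> dz j t = 0.
  move=> jk tsb; apply/eqP; rewrite -(inj_eq (addIr (z j.+1 t))) add0r.
  by rewrite -yS 1?ltnW// yz.
have dzk t : t \in `[s, b] -> dz k.-1 t = w t.
  have := @yS k.-1 t; rewrite prednK// => ykE tsb.
  by rewrite /w ykE// addrK.
pose F t := 2^-1 *: pairing k y r t.
pose F1 t := \sum_(j < k) (dot (y j.+1 t) (r j.+1 t) +
               dot (y j t) (dr j.+1 t + (G j t - r j t))).
exists F, (fun t => 2^-1 *: F1 t), w; split=> //.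
- apply: seg_D_scalel; rewrite /pairing /F1; apply: seg_D_sum => j _.
  by apply: seg_D_dot; [exact: y_jet|exact: Dr].
- move=> t tsb.
  have Mt j : (j <= k)%N -> (Md j t)^T = Md j t by move=> jk; apply: Md_sym.
  have -> : lagrangian k Md Mo t (y^~ t) =
      lagrangian k Md Mo t (fun j => z j t + at_index k (w t) j).
    apply: lagrangian_ext => j; rewrite leq_eqVlt /at_index => /predU1P[->|jk].
      by rewrite eqxx /w addrC subrK.
    by rewrite ltn_eqF// addr0 yz.
  rewrite lagrangianD// lagrangian_at_top polarC// polar_at_index//.
  rewrite -/(G k t); congr (_ + _).
  have -> : F1 t = \sum_(j < k) dot (y j t) (dr j.+1 t) +
     (\sum_(j < k) dot (y j t) (G j t) + dot (y k t) (r k t)).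
    rewrite -(@pairing_telescope _ k n (y^~ t) (r^~ t) (G^~ t) (r0 t tsb)).
    rewrite -big_split; apply: eq_bigr => j _ /=.
    by rewrite [X in _ + X = _]dotDr [LHS]addrCA.
  have -> : \sum_(j < k) dot (y j t) (dr j.+1 t) = dot (w t) (G k t).
    transitivity (\sum_i \sum_l c' i t * c t 0 l * pairing k (x l) (p i) t).
      rewrite /dr; under eq_bigr do rewrite dot_sumr.
      rewrite exchange_big; apply: eq_bigr => i _ /=.
      under [RHS]eq_bigr do rewrite /pairing mulr_sumr.
      rewrite exchange_big; apply: eq_bigr => j _ /=.
      rewrite yz// dotZr dot_suml mulr_sumr; apply: eq_bigr => l _.
      by rewrite dotZl mulrA.
    transitivity (\sum_(j < k) dot (dz j t) (r j.+1 t)).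
      rewrite /dz; under [RHS]eq_bigr do rewrite dot_suml.
      rewrite [RHS]exchange_big; apply: eq_bigr => i _ /=.
      under eq_bigr do rewrite xp_sym// /pairing mulr_sumr.
      rewrite exchange_big; apply: eq_bigr => j _ /=.
      rewrite dotZl dot_sumr mulr_sumr; apply: eq_bigr => l _.
      by rewrite dotZr mulrA.
    rewrite -dzk// -rk//; case: (k) k0 dz0 => // k' _ dz0.
    rewrite big_ord_recr/= big1 ?add0r// => j _.
    by rewrite dz0 ?dot0l// ltnS.
  rewrite lagrangian_polar /polar big_ord_recr/= -/(G k t).
  have -> : \sum_(j < k) dot (y j t) (G j t) = \sum_(j < k) dot (z j t) (G j t).
    by apply: eq_bigr => j _; rewrite yz.
  by rewrite rk// /w dotDl dotNl /GRing.scale/=; field.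
- move=> w0 t tsb; apply/rowP => i.
  apply: (seg_D_eq0_cst (ltW sb) (Dc i) _ tsb) => u usb.
  have usb' : u \in `[s, b] by apply: subset_itv_oo_cc.
  have : (\row_i c' i u) *m stack_mx k x u = 0.
    apply/rowP => m; case/mxvec_indexP: m => j l.
    rewrite mulmx_stack mxE.
    under eq_bigr do rewrite mxE.
    rewrite -/(dz j u); have [jk|kj] := ltnP j.+1 k; first by rewrite dz0// mxE.
    have -> : (j : nat) = k.-1.
      by apply/eqP; rewrite eqn_leq -ltnS prednK// ltn_ord -ltnS prednK.
    by rewrite dzk// w0// mxE.
  move=> /(congr1 (mulmx^~ (invmx (stack_mx k x u)))).
  by rewrite mulmxK ?x_unit// mul0mx => /rowP/(_ i); rewrite !mxE.
Qed.

End Picone.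

(** * Coercivity on short segments *)

Section ShortSegments.
Context {R : realType}.
Variables (a b : R) (k n : nat) (Md Mo : nat -> R -> 'M[R]_n).
Hypothesis Md_diff : forall j, (j <= k)%N -> seg_diff a b (Md j).
Hypothesis Mo_diff : forall j, (j < k)%N -> seg_diff a b (Mo j).

Definition lower_energy (q : nat -> 'cV[R]_n) : R := \sum_(j < k) dot (q j) (q j).

Lemma lower_energy_ge0 q : 0 <= lower_energy q.
Proof. by apply: sumr_ge0 => j _; apply: dot_ge0. Qed.

Lemma lower_energy_shift q :
  \sum_(j < k) dot (q j.+1) (q j.+1) <= lower_energy q + dot (q k) (q k).
Proof.
rewrite /lower_energy -(big_ord_recr k (fun j => dot (q j) (q j))) big_ord_recl.
by rewrite lerDr dot_ge0.
Qed.

Lemma coefficients_bounded : exists2 K, 0 <= K & forall t, t \in `[a, b] ->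
  (forall j, (j <= k)%N -> forall i l, `|Md j t i l| <= K) /\
  (forall j, (j < k)%N -> forall i l, `|Mo j t i l| <= K).
Proof.
have hd (j : 'I_k.+1) : exists K, 0 <= K /\
    forall t, t \in `[a, b] -> forall i l, `|Md j t i l| <= K.
  have [K K0 HK] := seg_diff_mx_bounded (Md_diff (ltn_ord j : (j <= k)%N)).
  by exists K.
have ho (j : 'I_k) : exists K, 0 <= K /\
    forall t, t \in `[a, b] -> forall i l, `|Mo j t i l| <= K.
  by have [K K0 HK] := seg_diff_mx_bounded (Mo_diff (ltn_ord j)); exists K.
have [Kd HKd] := choice hd; have [Ko HKo] := choice ho.
have Kd0 : 0 <= \sum_j Kd j by apply: sumr_ge0 => j _; have [] := HKd j.
have Ko0 : 0 <= \sum_j Ko j by apply: sumr_ge0 => j _; have [] := HKo j.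
exists (\sum_j Kd j + \sum_j Ko j) => [|t tab]; first exact: addr_ge0.
split=> j jk i l.
  rewrite -ltnS in jk; have [_ H] := HKd (Ordinal jk).
  apply: le_trans (H t tab i l) _; apply: ler_wpDr => //.
  rewrite (bigD1 (Ordinal jk))//= lerDl sumr_ge0// => m _; by have [] := HKd m.
have [_ H] := HKo (Ordinal jk).
apply: le_trans (H t tab i l) _; apply: ler_wpDl => //.
rewrite (bigD1 (Ordinal jk))//= lerDl sumr_ge0// => m _; by have [] := HKo m.
Qed.

(** Only the term in [q (k - 1)] and [q k] mixes the top derivative with the
    lower ones; with a small weight its share of [dot (q k) (q k)] is absorbed by
    the Legendre condition. *)
Lemma lagrangian_garding l : 0 < l ->
  (forall t, t \in `[a, b] -> forall u, l * dot u u <= dot u (Md k t *m u)) ->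
  exists m C, [/\ 0 < m, 0 <= C & forall t q, t \in `[a, b] ->
    m * dot (q k) (q k) - C * lower_energy q <= lagrangian k Md Mo t q].
Proof.
move=> l0 lM; have [K K0 HK] := coefficients_bounded.
pose N : R := n%:R.
have N0 : 0 <= N by [].
(* The weight is chosen so that [N * e <= l / 4]; the shift by 1 avoids a division
   by zero when [n = 0]. *)
pose e := l / (4 * (N + 1)).
have e0 : 0 < e by rewrite divr_gt0// mulr_gt0// ltr_wpDl.
have Ne : N * e <= l / 4.
  have -> : l / 4 = (N + 1) * e by rewrite /e; field; rewrite gt_eqF// ltr_wpDl.
  by apply: ler_wpM2r; [exact: ltW|rewrite lerDl].
pose C := N * (1 + K ^+ 2 + K ^+ 2 / e).
have C0 : 0 <= C.
  by rewrite mulr_ge0// !addr_ge0// ?sqr_ge0// divr_ge0 ?sqr_ge0// ltW.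
exists (l / 4), (C + l / 4); split=> [||t q tab]; first by rewrite divr_gt0.
  by rewrite addr_ge0// divr_ge0// ltW.
have [Hd Ho] := HK t tab.
have term (j : 'I_k) : - (C * dot (q j) (q j) + l / 4 * dot (q j.+1) (q j.+1)) <=
   2^-1 * dot (q j) (Md j t *m q j) + dot (q j) (Mo j t *m q j.+1).
  have := dot_mulmx_le (q j) (q j) ltr01 (Hd j (ltnW (ltn_ord j))).
  have := dot_mulmx_le (q j) (q j.+1) e0 (Ho j (ltn_ord j)).
  rewrite !ler_norml => /andP[h1 _] /andP[h2 _].
  have h3 : N * e * dot (q j.+1) (q j.+1) <= l / 4 * dot (q j.+1) (q j.+1).
    by rewrite ler_wpM2r// dot_ge0.
  have h4 : 0 <= N * (1 + K ^+ 2) * dot (q j) (q j).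
    by rewrite !mulr_ge0// ?dot_ge0// addr_ge0// sqr_ge0.
  rewrite /C; move: h1 h2 h3 h4; rewrite -/N divr1.
  set u := dot (q j) (q j); set v := dot (q j.+1) _; set K2 := K ^+ 2.
  set X := K2 / e => h1 h2 h3 h4.
  have -> : N * (1 + K2 + X) * u = N * (1 + K2) * u + N * X * u by ring.
  by lra.
have sum_term : - (C * lower_energy q + l / 4 * (lower_energy q + dot (q k) (q k))) <=
   \sum_(j < k) (2^-1 * dot (q j) (Md j t *m q j) + dot (q j) (Mo j t *m q j.+1)).
  apply: (@le_trans _ _ (\sum_(j < k)
    - (C * dot (q j) (q j) + l / 4 * dot (q j.+1) (q j.+1)))); last first.
    by apply: ler_sum => j _; apply: term.
  rewrite sumrN lerN2 big_split/= -!mulr_sumr lerD2l; apply: ler_wpM2l.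
    by rewrite divr_ge0// ltW.
  exact: lower_energy_shift.
have -> : lagrangian k Md Mo t q =
   \sum_(j < k) (2^-1 * dot (q j) (Md j t *m q j) + dot (q j) (Mo j t *m q j.+1))
   + 2^-1 * dot (q k) (Md k t *m q k).
  rewrite /lagrangian big_ord_recr/= mulrDr big_split/= -mulr_sumr addrAC.
  by rewrite /dot !mulmxA; congr (_ + _ + _ ); [congr (_ * _)|];
     apply: eq_bigr => j _; rewrite mulmxA.
have := lM t tab (q k).
by lra.
Qed.

(** For [f = al * (t - a)] the square of [y j.+1 + f *: y j] is nonnegative, so
    that [|y j.+1|^2] is at least
    [(al - f^2) |y j|^2] up to the derivative of [- f |y j|^2].  If [t - a] is
    small then [f^2 <= al / 2], hence a large [al] makes the energy of the top
    derivative dominate any multiple of the lower ones.  The term [H] is zero at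
    [a] because [f] is, and at [s] because [y] is. *)
Lemma weighted_poincare m C : 0 < m -> 0 <= C -> exists2 d, 0 < d &
  forall s (y : nat -> R -> 'cV[R]_n), a < s -> s <= a + d -> is_jet a s k y ->
  (forall j, (j < k)%N -> y j s = 0) ->
  exists H H', [/\ seg_D a s H H', H a = 0, H s = 0
    & forall t, t \in `[a, s] -> H' t + lower_energy (y^~ t) <=
        m * dot (y k t) (y k t) - C * lower_energy (y^~ t)].
Proof.
move=> m0 C0; pose al := 2 * ((C + 1) / m + 1).
(* This choice gives [m * (al / 2 - 1) = C + 1], the unit in excess paying for
   the energy on the left-hand side. *)
have al2 : 2 <= al.
  have : 0 <= (C + 1) / m by apply: divr_ge0; [exact: addr_ge0|exact: ltW].
  by rewrite /al; lra.
have al0 : 0 < al by lra.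
(* As [al >= 2], this makes both [al * (t - a)] and [t - a] at most 1/2. *)
exists (2 * al)^-1; first by rewrite invr_gt0 mulr_gt0.
move=> s y as_ sd jy ys.
pose E t := lower_energy (y^~ t).
pose E' t := \sum_(j < k) (dot (y j.+1 t) (y j t) + dot (y j t) (y j.+1 t)).
have DE : seg_D a s E E'.
  by rewrite /E /lower_energy; apply: seg_D_sum => j _; apply: seg_D_dot; apply: jy.
pose ph t := - (m * al) * (t - a).
have Dph : seg_D a s ph (fun=> - (m * al)).
  have := seg_D_scalel (c := - (m * al)) (seg_D_add (@seg_D_id _ a s) (seg_D_cst (- a))).
  by apply: seg_D_ext => t _ //; rewrite addr0 [_ *: _]mulr1.
exists (fun t => ph t * E t), (fun t => - (m * al) * E t + ph t * E' t); split.
- exact: seg_D_mul.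
- by rewrite /ph subrr mulr0 mul0r.
- by rewrite /E /lower_energy big1 ?mulr0// => j _; rewrite ys// dot0l.
move=> t; rewrite in_itv /= => /andP[at_ ts].
pose f := al * (t - a).
have f2 : f ^+ 2 <= al / 2.
  have ta0 : 0 <= t - a by rewrite subr_ge0.
  have tal : al * (t - a) <= 2^-1.
    have : al * (t - a) <= al * (2 * al)^-1.
      by apply: ler_wpM2l; [exact: ltW|rewrite lerBlDl (le_trans ts)].
    by rewrite invfM mulrCA divff ?mulr1// gt_eqF.
  rewrite /f exprMn.
  have -> : al ^+ 2 * (t - a) ^+ 2 = (al * (t - a)) * (al * (t - a)) by ring.
  have : 0 <= al * (t - a) by rewrite mulr_ge0// ltW.
  by nra.
have EE' : - f * E' t <= \sum_(j < k) dot (y j.+1 t) (y j.+1 t) + al / 2 * E t.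
  rewrite /E /lower_energy /E' !mulr_sumr -big_split; apply: ler_sum => j _ /=.
  have := dot_ge0 (y j.+1 t + f *: y j t).
  rewrite !(dotDl, dotDr, dotZl, dotZr) [dot (y j t) (y j.+1 t)]dotC.
  have : f ^+ 2 * dot (y j t) (y j t) <= al / 2 * dot (y j t) (y j t).
    by rewrite ler_wpM2r// dot_ge0.
  by rewrite expr2; lra.
have sh := lower_energy_shift (y^~ t).
have mf : ph t * E' t = m * (- f * E' t) by rewrite /ph /f; ring.
have ma : m * al = 2 * (C + 1) + 2 * m by rewrite /al; field; rewrite gt_eqF.
have h : m * (- f * E' t) <= m * (E t + dot (y k t) (y k t) + al / 2 * E t).
  apply: ler_wpM2l; first exact: ltW.
  by apply: (le_trans EE'); rewrite lerD2r.
have h' : m * (al / 2 * E t) = (C + 1 + m) * E t.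
  by transitivity (m * al * E t / 2); [ring|rewrite ma; field].
rewrite -/(E t) mf ma; nra.
Qed.

End ShortSegments.

(** * Positive definiteness *)

Section DifferentiableLagrangian.
Context {R : realType}.

Lemma seg_diff_lagrangian n k a b (Md Mo : nat -> R -> 'M[R]_n) (y : nat -> R -> 'cV[R]_n) :
  (forall j, (j <= k)%N -> seg_diff a b (Md j)) ->
  (forall j, (j < k)%N -> seg_diff a b (Mo j)) ->
  (forall j, (j <= k)%N -> seg_diff a b (y j)) ->
  seg_diff a b (fun t => lagrangian k Md Mo t (y^~ t)).
Proof.
move=> dMd dMo dy.
have form i j (A : R -> 'M[R]_n) : seg_diff a b A -> (i <= k)%N -> (j <= k)%N ->
    seg_diff a b (fun t => ((y i t)^T *m A t *m y j t) 0 0).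
  move=> [A' DA] /dy[y1 Dy1] /dy[y2 Dy2].
  have /seg_D_mxP D := seg_D_mulmx (seg_D_mulmx (seg_D_trmx Dy1) DA) Dy2.
  by eexists; apply: (D 0 0).
have [g1 D1] : seg_diff a b (fun t => \sum_(i < k.+1) ((y i t)^T *m Md i t *m y i t) 0 0).
  by apply: seg_diff_sum => i; apply: form; [apply: dMd| |]; rewrite -ltnS.
have [g2 D2] : seg_diff a b (fun t => \sum_(i < k) ((y i t)^T *m Mo i t *m y i.+1 t) 0 0).
  by apply: seg_diff_sum => i; apply: form; [apply: dMo|exact: ltnW|].
by eexists; apply: seg_D_add (seg_D_scalel (c := 2^-1) D1) D2.
Qed.

End DifferentiableLagrangian.

Section Definiteness.
Context {R : realType}.
Variables (a b : R) (k n : nat) (Md Mo : nat -> R -> 'M[R]_n).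
Hypothesis ab : a < b.
Hypothesis k0 : (0 < k)%N.
Hypothesis Md_diff : forall j, (j <= k)%N -> seg_diff a b (Md j).
Hypothesis Mo_diff : forall j, (j < k)%N -> seg_diff a b (Mo j).
Hypothesis Md_sym : forall j, (j <= k)%N -> forall t, t \in `[a, b] ->
  (Md j t)^T = Md j t.
Hypothesis Mk_pos : forall t, t \in `[a, b] -> posdefmx (Md k t).
Variables x p : 'I_(k * n) -> nat -> R -> 'cV[R]_n.
Hypothesis xp : forall i, extremal a b k Md Mo (x i) (p i).
Hypothesis xa : forall i j, (j < k)%N -> x i j a = 0.
Hypothesis x_unit : forall t, t \in `]a, b] -> stack_mx k x t \in unitmx.

(** The frame is invertible on [s, b] for any [s > a], but it is zero at [a].
    Thus [s] is taken close to [a].  On [s, b] the Lagrangian of [y] is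
    the derivative of [F] plus a square, by [picone].  On [a, s] it is compared
    with that of the extremal [z] obtained by freezing the coefficients at [s]:
    [L y = L z + polar u z + L u] with [u = y - z], where the first two terms are
    derivatives by Green's formula, and [L u] is at least a derivative plus
    [lower_energy u], since [u] has zero jets at both ends of the short segment.
    The two primitives agree at [s] and vanish at [a] and [b]. *)
Lemma conjugate_free_posdef (y : nat -> R -> 'cV[R]_n) :
  is_jet a b k y -> seg_diff a b (y k) ->
  (forall j, (j < k)%N -> y j a = 0 /\ y j b = 0) ->
  let I := \int[lebesgue_measure]_(t in `[a, b]) lagrangian k Md Mo t (y^~ t) in
  0 <= I /\ (I = 0 -> forall t, t \in `[a, b] -> y 0%N t = 0).
Proof.
move=> jy dyk yends I.
have [l l0 Hl] := posdefmx_coercive (Md_diff (leqnn k)) (Md_sym (leqnn k)) Mk_pos.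
have [m [C [m0 C0 garding]]] := lagrangian_garding Md_diff Mo_diff l0 Hl.
have [d d0 poincare] := weighted_poincare a k n m0 C0.
pose s := Num.min (a + d) ((a + b) / 2).
have as_ : a < s by rewrite lt_min ltrDl d0 midf_lt.
have sb : s < b by rewrite gt_min (midf_lt ab) orbT.
have sd : s <= a + d by rewrite ge_min lexx.
have [leas lesb] : a <= s /\ s <= b by split; apply: ltW.
have sub1 t : t \in `[a, s] -> t \in `[a, b] by apply: itv_cc_sub.
have sub2 t : t \in `[s, b] -> t \in `[a, b] by apply: itv_cc_sub.
have sub2' t : t \in `[s, b] -> t \in `]a, b].
  by rewrite !in_itv /= => /andP[st ->]; rewrite (lt_le_trans as_).
have x_sym i j t : t \in `[a, b] -> pairing k (x i) (p j) t = pairing k (x j) (p i) t.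
  by apply: (pairing_sym ab Md_sym (xp i) (xp j)) => j' j'k; apply: xa.
have xp2 i : extremal s b k Md Mo (x i) (p i) by apply: extremal_subseg (xp i).
have jy2 : is_jet s b k y by apply: is_jet_sub jy.
have x_unit2 t : t \in `[s, b] -> stack_mx k x t \in unitmx by move=> /sub2'/x_unit.
have [F [F' [w [DF FE LF wc]]]] := picone sb k0
  (fun j jk t tsb => Md_sym jk (sub2 t tsb)) xp2
  (fun i j t tsb => x_sym i j t (sub2 t tsb)) x_unit2 jy2.
set c := frame_coef x y in FE wc.
pose z j t := \sum_i c s 0 i *: x i j t.
pose q j t := \sum_i c s 0 i *: p i j t.
have zq : extremal a s k Md Mo z q.
  by apply: extremal_subseg (extremal_sum _ _ xp).
have [jz _ _ _] := zq.
have za j : (j < k)%N -> z j a = 0.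
  by move=> jk; rewrite /z big1// => i _; rewrite xa// scaler0.
have ssb : s \in `[s, b] by rewrite in_itv /= lexx.
have bsb : b \in `[s, b] by rewrite in_itv /= lexx lesb.
have zs j : (j < k)%N -> z j s = y j s.
  by move=> jk; rewrite (frame_coefP x_unit2 y jk ssb).
pose u j t := y j t - z j t.
have jy1 : is_jet a s k y by apply: is_jet_sub jy.
have ju : is_jet a s k u.
  move=> j jk; have := seg_D_add (jy1 j jk) (seg_D_scalel (c := -1) (jz j jk)).
  by apply: seg_D_ext => t _; rewrite scaleN1r.
have ua j : (j < k)%N -> u j a = 0.
  by move=> jk; rewrite /u za// (yends j jk).1 subrr.
have us j : (j < k)%N -> u j s = 0 by move=> jk; rewrite /u zs// subrr.
have [H [H' [DH Ha Hs HE]]] := poincare s u as_ sd ju us.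
pose F1 t := 2^-1 *: pairing k z q t + pairing k u q t + H t.
pose F1' t := 2^-1 *: polar k Md Mo t (z^~ t) (z^~ t)
  + polar k Md Mo t (u^~ t) (z^~ t) + H' t.
have DF1 : seg_D a s F1 F1'.
  apply: seg_D_add DH; apply: seg_D_add; last exact: seg_D_pairing.
  by apply: seg_D_scalel; apply: seg_D_pairing.
have pairing0 (v r : nat -> R -> 'cV[R]_n) t :
    (forall j, (j < k)%N -> v j t = 0) -> pairing k v r t = 0.
  by move=> v0; rewrite /pairing big1// => j _; rewrite v0// dot0l.
have F1a : F1 a = 0 by rewrite /F1 !pairing0// Ha scaler0 !addr0.
have F1s : F1 s = F s.
  rewrite /F1 (pairing0 u)// Hs !addr0 FE//; congr (_ * _).
  by apply: eq_bigr => j _; rewrite zs.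
have Fb : F b = 0.
  by rewrite FE// pairing0 ?mulr0// => j jk; rewrite (yends j jk).2.
have LF1 t : t \in `[a, s] ->
    F1' t + lower_energy k (u^~ t) <= lagrangian k Md Mo t (y^~ t).
  move=> tas; have tab := sub1 t tas.
  have Mt j : (j <= k)%N -> (Md j t)^T = Md j t by move=> jk; apply: Md_sym.
  have -> : lagrangian k Md Mo t (y^~ t) = lagrangian k Md Mo t (fun j => z j t + u j t).
    by apply: lagrangian_ext => j _; rewrite /u addrC subrK.
  rewrite lagrangianD// (lagrangian_polar k Md Mo t (z^~ t)).
  rewrite [polar _ _ _ _ (z^~ t) (u^~ t)]polarC//.
  have := garding t (u^~ t) tab; have := HE t tas.
  by rewrite /F1' /GRing.scale/=; lra.
have Lc : {within `[a, b], continuous (fun t => lagrangian k Md Mo t (y^~ t))}.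
  have dy j : (j <= k)%N -> seg_diff a b (y j).
    by rewrite leq_eqVlt => /predU1P[->//|jk]; exists (y j.+1); apply: jy.
  have [L' DL] := seg_diff_lagrangian Md_diff Mo_diff dy.
  exact: seg_D_continuous DL.
have Lc1 : {within `[a, s], continuous (fun t => lagrangian k Md Mo t (y^~ t))}.
  by apply: continuous_subspaceW Lc => t /=; apply: sub1.
have Lc2 : {within `[s, b], continuous (fun t => lagrangian k Md Mo t (y^~ t))}.
  by apply: continuous_subspaceW Lc => t /=; apply: sub2.
have le1 t : t \in `[a, s] -> F1' t <= lagrangian k Md Mo t (y^~ t).
  by move=> /LF1; have := lower_energy_ge0 k (u^~ t); lra.
have w_ge0 t : t \in `[s, b] -> 0 <= dot (w t) (Md k t *m w t).
  move=> tsb; have [->|wt] := eqVneq (w t) 0; first by rewrite dot0l.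
  by have := Mk_pos (sub2 t tsb) wt; rewrite -mulmxA => /ltW.
have le2 t : t \in `[s, b] -> F' t <= lagrangian k Md Mo t (y^~ t).
  by move=> tsb; rewrite LF//; have := w_ge0 t tsb; lra.
have [I1 eq1] := FTC_le as_ Lc1 DF1 le1.
have [I2 eq2] := FTC_le sb Lc2 DF le2.
have IE : I = _ := Rintegral_split as_ sb Lc.
rewrite F1a F1s subr0 in I1 eq1; rewrite Fb sub0r in I2 eq2.
split=> [|I0]; first by rewrite IE; lra.
rewrite I0 in IE.
have w0 t : t \in `]s, b[ -> w t = 0.
  move=> tsb; have tsb' : t \in `[s, b] by apply: subset_itv_oo_cc.
  have E := eq2 ltac:(lra) t tsb.
  apply/eqP/negP => /negP wt.
  have := Mk_pos (sub2 t tsb') wt; rewrite -mulmxA -/(dot _ _).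
  by have := LF t tsb'; rewrite E; lra.
(* The coefficients are constant, and zero at [b] because the jet of [y] is. *)
have c0 t : t \in `[s, b] -> c t = 0.
  move=> tsb; rewrite (wc w0 t tsb) /c /frame_coef.
  have -> : stack_mx k (fun _ : 'I_1 => y) b = 0.
    apply/matrixP => i r; case/mxvec_indexP: r => j l'.
    by rewrite stack_mxE (yends j (ltn_ord j)).2 !mxE.
  by rewrite mul0mx.
move=> t tab; have [st|ts] := leP s t.
  have tsb : t \in `[s, b] by move: tab; rewrite !in_itv /= st => /andP[].
  rewrite (frame_coefP x_unit2 y k0 tsb) -/c c0// big1// => i _.
  by rewrite mxE scale0r.
have [ta|at_] := leP t a.
  have -> : t = a.
    by apply/eqP; rewrite eq_le ta; move: tab; rewrite in_itv => /andP[].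
  by have [] := yends 0%N k0.
have tas : t \in `]a, s[ by rewrite in_itv /= at_.
have E := eq1 ltac:(lra) t tas.
have e0 : lower_energy k (u^~ t) <= 0.
  by have := LF1 t (subset_itv_oo_cc tas); rewrite E; lra.
have z0 : z 0%N t = 0.
  by rewrite /z big1// => i _; rewrite c0// mxE scale0r.
have : dot (u 0%N t) (u 0%N t) <= 0.
  apply: le_trans e0; rewrite /lower_energy (bigD1 (Ordinal k0))//= lerDl.
  by apply: sumr_ge0 => j _; apply: dot_ge0.
rewrite /u z0 subr0 => h.
by apply/eqP; rewrite -dot_eq0 eq_le h dot_ge0.
Qed.

End Definiteness.

Theorem theorem4p9 (R : realType) (a b : R) (k n : nat)
    (Md Mo : nat -> R -> 'M[R]_n)
    (h : 'I_(k * n + k * n) -> R -> 'cV[R]_n) :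
  a < b -> (1 <= k)%N -> (1 <= n)%N ->
  (forall i, (i <= k)%N -> seg_smooth a b (Md i)) ->
  (forall i, (i < k)%N -> seg_smooth a b (Mo i)) ->
  (forall i, (i <= k)%N -> forall t, t \in `[a, b] -> (Md i t)^T = Md i t) ->
  (forall t, t \in `[a, b] -> posdefmx (Md k t)) ->
  fundamental_set a b k Md Mo h ->
  (forall (i : 'I_(k * n)) (j : nat), (j < k)%N ->
     seg_derivn a b j (h (lshift (k * n) i)) a = 0) ->
  (forall t, t \in `]a, b] ->
     (jacobi_curve a b k h t :&: vertical_space (k * n) (k * n) = 0)%VS) ->
  quad_functional_posdef a b k Md Mo.
Proof.
move=> ab k0 _ Md_smooth Mo_smooth Md_sym Mk_pos [h_sol h_free _] ha trans g g_smooth g_ends.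
have Md_diff i : (i <= k)%N -> seg_diff a b (Md i).
  by move=> ik; apply/seg_smooth_diff/Md_smooth.
have Mo_diff i : (i < k)%N -> seg_diff a b (Mo i).
  by move=> ik; apply/seg_smooth_diff/Mo_smooth.
pose x i j := seg_derivn a b j (h i).
pose p i := momentum a b k Md Mo (h i).
have xp i : extremal a b k Md Mo (x i) (p i) by apply: jacobi_extremal.
have x_unit t : t \in `]a, b] -> stack_mx k (fun i => x (lshift (k * n) i)) t \in unitmx.
  move=> tab; have tab' : t \in `[a, b] by apply: subset_itv_oc_cc.
  apply: (frame_unit k0 Md_diff Mo_diff _ xp _ tab' _ (trans t tab)).
  - by move=> s sab; apply/posdefmx_unit/Mk_pos.
  - by move=> d d0; apply: h_free.
  - move=> j i l; apply: (@seg_derivn_row _ _ _ ab _ _ (2 * k)) => //.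
      by move=> i'; have [] := h_sol i'.
    by rewrite (leq_trans (ltnW (ltn_ord j)))// mul2n -addnn leq_addr.
pose y j := seg_derivn a b j g.
have jy : is_jet a b k y by move=> j _; apply: seg_D_derivn (g_smooth j.+1) _.
have dyk : seg_diff a b (y k).
  by exists (y k.+1); apply: seg_D_derivn (g_smooth k.+1) _.
have := conjugate_free_posdef ab k0 Md_diff Mo_diff Md_sym Mk_pos
  (fun i => xp (lshift (k * n) i)) (fun i j jk => ha i j jk) x_unit jy dyk g_ends.
exact.
Qed.
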